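(* Let $d>1$, $\mathcal{X}=\mathbb{S}_{d-1}(\sqrt d)$ the sphere of radius $\sqrt d$ in $\mathbb{R}^d$, $\mu$ the uniform distribution on $\mathcal{X}$, and let $\mathcal{G}$ act on $\mathcal{X}$ via an orthogonal representation $\phi$; set $\Phi=\int_\mathcal{G}\phi(g)\,d\lambda(g)$. Let $k(x,y)=x^\top y$ and let $f^\star(x)=\theta^\top x$ for some $\theta\in\mathbb{R}^d$ with $f^\star$ $\mathcal{G}$-invariant. Let the training sample $(X_i,Y_i)_{i=1}^n$ be i.i.d. with $X_i\sim\mu$, $Y_i=f^\star(X_i)+\xi_i$, $\mathbb{E}[\xi_i\mid X_1,\dots,X_n]=0$, $\mathbb{E}[\xi_i\xi_j\mid X_1,\dots,X_n]=\delta_{ij}$; let $X\sim\mu$, $Y=f^\star(X)+\xi$, $\mathbb{E}[\xi\mid X]=0$, $\mathbb{E}[\xi^2]=1$. For $\rho>0$ let $f(x)=k_{\mathbf{X}}(x)^\top(K+\rho I)^{-1}\mathbf{Y}$ be the kernel ridge regression solution, $K_{ij}=k(X_i,X_j)$, with eigenvalues $\gamma_1,\dots,\gamma_n$ of $K$, and let $f'$ be any predictor with $R[f']\le R[\mathcal{O}f]$. Define $\zeta_1(\rho)=\mathbb{E}\big[\sum_{i=1}^n\frac{\gamma_i^2}{(\gamma_i+\rho)^2}\big]$ and $\zeta_2(\rho)=\mathbb{E}\big[\big(\sum_{i=1}^n\frac{\gamma_i}{\gamma_i+\rho}\big)^2\big]$. Then \[\mathbb{E}[R[f]-R[f']]\ge\frac{\|\theta\|_2^2(d\zeta_1(\rho)-\zeta_2(\rho))(d-\|\Phi\|_F^2)}{d(d+2)(d-1)}+\frac{d-\|\Phi\|_F^2}{(d\sqrt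 n+\rho/\sqrt n)^2},\] where each term is non-negative, the first term equals $\mathbb{E}[\|(\mathrm{id}-\mathcal{O})\Lambda_{n,\rho}f^\star\|_\mu^2]$ and the second equals $\|k^\perp\|^2_{L_2(\mu\otimes\mu)}/(\sqrt nM_k+\rho/\sqrt n)^2$ with $M_k=\sup_xk(x,x)=d$.
   Context: $\mathcal{G}$ is a compact, second countable, Hausdorff topological group with Haar probability measure $\lambda$; $\phi$ is a measurable orthogonal representation. $\mathcal{O}h(x)=\int_\mathcal{G}h(\phi(g)x)d\lambda(g)$; $\|\cdot\|_\mu$ is the $L_2(\mu)$ norm; $\|\cdot\|_F$ the Frobenius norm. $k_{\mathbf{X}}(x)_i=k(X_i,x)$, $\mathbf{Y}_i=Y_i$. $\Lambda_{n,\rho}f^\star$ is the minimiser over the RKHS $\mathcal{H}$ of $k$ of $\sum_{i=1}^n(h(X_i)-f^\star(X_i))^2+\rho\|h\|_\mathcal{H}^2$. $k^\perp(x,y)=k(x,y)-\int_\mathcal{G}k(x,\phi(g)y)d\lambda(g)$, $\|j\|^2_{L_2(\mu\otimes\mu)}=\iint j(x,y)^2d\mu(x)d\mu(y)$. The risk is $R[h]=\mathbb{E}[(h(X)-Y)^2]$ conditional on the training sample; the outer expectation is over the training sample. *)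

(* Defs.v *)
From HB Require Import structures.
From mathcomp Require Import all_boot all_order all_algebra.
From mathcomp Require Import all_classical all_reals all_analysis.
From mathcomp Require Import measurable_realfun.
Set Implicit Arguments. Unset Strict Implicit. Unset Printing Implicit Defensive.
Import Order.TTheory GRing.Theory Num.Theory.
Local Open Scope classical_set_scope.
Local Open Scope ring_scope.

(* ---------- Euclidean space R^d, modelled as d.-tuple R (product =     *)
(* Borel sigma-algebra, provided by MathComp-Analysis)                   *)
Definition dotv {R : realType} {d : nat} (x y : d.-tuple R) : R :=
  \sum_(i < d) tnth x i * tnth y i.

Definition actv {R : realType} {d : nat} (M : 'M[R]_d) (x : d.-tuple R)
  : d.-tuple R := [tuple \sum_(j < d) M i j * tnth x j | i < d].

Definition orthogonal_mx {R : realType} {d : nat} (Q : 'M[R]_d) : Prop :=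
  Q^T *m Q = 1%:M.

Definition sphere (R : realType) (d : nat) : set (d.-tuple R) :=
  [set x | dotv x x = d%:R].

(* mu is the uniform distribution on S_{d-1}(sqrt d): the (unique)
   probability measure concentrated on the sphere that is invariant under
   every orthogonal transformation (normalised surface measure). *)
Definition uniform_on_sphere (R : realType) (d : nat)
  (mu : probability (d.-tuple R) R) : Prop :=
  mu (@sphere R d) = 1%E /\
  forall Q : 'M[R]_d, orthogonal_mx Q ->
    forall A : set (d.-tuple R), measurable A -> mu (actv Q @^-1` A) = mu A.

Definition frob2 {R : realType} {d : nat} (M : 'M[R]_d) : R :=
  \sum_(i < d) \sum_(j < d) M i j ^+ 2.

Definition topological_group (G : ptopologicalType)
  (mul : G -> G -> G) (inv : G -> G) (e : G) : Prop :=
  [/\ associative mul, left_id e mul, left_inverse e inv mul,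
      continuous (fun p : G * G => mul p.1 p.2) & continuous inv].

Definition compact_sc_hausdorff (G : ptopologicalType) : Prop :=
  [/\ compact [set: G], @second_countable G & hausdorff_space G].

Notation BorelG G := (g_sigma_algebraType (@open G)).

(* Haar probability measure: left-translation invariant Borel probability
   (on a compact second countable group every finite Borel measure is
   regular, so no separate regularity condition is needed). *)
Definition haar_probability (R : realType) (G : ptopologicalType)
  (mul : G -> G -> G) (lam : probability (BorelG G) R) : Prop :=
  forall (g : G) (A : set (BorelG G)), measurable A ->
    lam [set mul g a | a in A] = lam A.

Definition measurable_orth_rep (R : realType) (d : nat) (G : ptopologicalType)
  (mul : G -> G -> G) (e : G) (phi : G -> 'M[R]_d) : Prop :=
  [/\ phi e = 1%:M,
      (forall g h, phi (mul g h) = phi g *m phi h),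
      (forall g, orthogonal_mx (phi g)) &
      (forall i j, measurable_fun [set: BorelG G] (fun g : BorelG G => phi g i j))].

Definition avg_mx (R : realType) (d : nat) (G : ptopologicalType)
  (lam : probability (BorelG G) R) (phi : G -> 'M[R]_d) : 'M[R]_d :=
  \matrix_(i, j) Rintegral lam [set: BorelG G] (fun g : BorelG G => phi g i j).

Definition avgO (R : realType) (d : nat) (G : ptopologicalType)
  (lam : probability (BorelG G) R) (phi : G -> 'M[R]_d)
  (h : d.-tuple R -> R) (x : d.-tuple R) : R :=
  Rintegral lam [set: BorelG G] (fun g : BorelG G => h (actv (phi g) x)).

Definition L2norm2 (R : realType) (d : nat) (mu : probability (d.-tuple R) R)
  (h : d.-tuple R -> R) : \bar R :=
  (\int[mu]_x ((h x) ^+ 2)%:E)%E.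

Definition mutually_independent (R : realType) {dO} {Omega : measurableType dO}
  (P : probability Omega R) {dT} {T : measurableType dT} (n : nat)
  (Z : 'I_n -> Omega -> T) : Prop :=
  forall A : 'I_n -> set T, (forall i, measurable (A i)) ->
    P (\bigcap_(i in [set: 'I_n]) (Z i @^-1` A i)) =
    (\prod_(i < n) P (Z i @^-1` A i))%E.

Definition identically_distributed (R : realType) {dO} {Omega : measurableType dO}
  (P : probability Omega R) {dT} {T : measurableType dT} (n : nat)
  (Z : 'I_n -> Omega -> T) : Prop :=
  forall i j (A : set T), measurable A -> P (Z i @^-1` A) = P (Z j @^-1` A).

Definition has_law (R : realType) {dO} {Omega : measurableType dO}
  (P : probability Omega R) {dT} {T : measurableType dT}
  (Z : Omega -> T) (mu : probability T R) : Prop :=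
  measurable_fun [set: Omega] Z /\
  forall A : set T, measurable A -> P (Z @^-1` A) = mu A.

(* E[xi | Z] = c (a.s.), via the defining property of conditional
   expectation: xi integrable and E[xi 1_B] = c P(B) for all B in sigma(Z) *)
Definition cond_exp_const (R : realType) {dO} {Omega : measurableType dO}
  (P : probability Omega R) {dT} {T : measurableType dT}
  (Z : Omega -> T) (xi : Omega -> R) (c : R) : Prop :=
  P.-integrable [set: Omega] (EFin \o xi) /\
  forall A : set T, measurable A ->
    (\int[P]_(w in Z @^-1` A) (xi w)%:E = c%:E * P (Z @^-1` A))%E.

Definition gram (R : realType) (d n : nat) (X : 'I_n -> d.-tuple R) : 'M[R]_n :=
  \matrix_(i, j) dotv (X i) (X j).

Definition krr (R : realType) (d n : nat) (X : 'I_n -> d.-tuple R)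
  (Y : 'I_n -> R) (rho : R) (x : d.-tuple R) : R :=
  ((\row_i dotv (X i) x) *m invmx (gram X + rho%:M) *m (\col_i Y i)) 0 0.

(* The RKHS of the linear kernel k(x,y) = x^T y on R^d consists of the
   functions x |-> w^T x with ||x |-> w^T x||_H = |w|.  [ridge_min X fs rho w]
   says that  x |-> w^T x  minimises
      sum_i (h(X_i) - fs(X_i))^2 + rho ||h||_H^2   over h in H,
   i.e. it is Lambda_{n,rho} fs. *)
Definition ridge_obj (R : realType) (d n : nat) (X : 'I_n -> d.-tuple R)
  (fs : d.-tuple R -> R) (rho : R) (w : d.-tuple R) : R :=
  \sum_(i < n) (dotv w (X i) - fs (X i)) ^+ 2 + rho * dotv w w.

Definition ridge_min (R : realType) (d n : nat) (X : 'I_n -> d.-tuple R)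
  (fs : d.-tuple R -> R) (rho : R) (w : d.-tuple R) : Prop :=
  forall v, ridge_obj X fs rho w <= ridge_obj X fs rho v.

Definition risk (R : realType) {dT} {OmegaT : measurableType dT}
  (Q : probability OmegaT R) (d : nat) (Xt : OmegaT -> d.-tuple R)
  (xit : OmegaT -> R) (fs : d.-tuple R -> R) (h : d.-tuple R -> R) : \bar R :=
  (\int[Q]_w ((h (Xt w) - (fs (Xt w) + xit w)) ^+ 2)%:E)%E.

(* Main.v *)
Require Import Defs.
From HB Require Import structures.
From mathcomp Require Import all_boot all_order all_algebra.
From mathcomp Require Import all_classical all_reals all_analysis.
From mathcomp Require Import measurable_realfun.
From mathcomp Require Import ring lra.
Set Implicit Arguments. Unset Strict Implicit. Unset Printing Implicit Defensive.
Import Order.TTheory GRing.Theory Num.Theory.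
Import numFieldNormedType.Exports.
Local Open Scope classical_set_scope.
Local Open Scope ring_scope.

(** Let [D] be the [n x d] matrix of the sample, [M = D^T (D D^T + rho)^-1] and
    [H = M D].  The ridge predictor has weights [v = H theta + M xi], and
    [H theta] are the weights of the noiseless minimiser.  Left invariance of
    the Haar measure gives [phi(g) Phi = Phi], hence [Phi^T Phi = Phi], so [Phi]
    is an orthogonal projection fixing [theta]; with [C = 1 - Phi], Pythagoras
    yields [R[f] - R[O f] = |C v|^2].  Conditionally on the sample the noise is
    centred with identity covariance, so
    [E |C v|^2 = E |C H theta|^2 + E |C M|_F^2].

    The joint law of the sample is invariant under rotations, which conjugate
    [H].  Since reflections act transitively on pairs of orthogonal vectors of
    given lengths, [E (u^T H v)^2 = beta |u|^2 |v|^2] whenever [u] and [v] are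
    orthogonal.  As [C theta = 0], the first term is
    [beta |theta|^2 |C|_F^2], and [beta] is found by taking expectations in
    [d tr (H^2) - (tr H)^2 =
     sum_(a <> b) (d H_ab^2 + (H_aa - H_bb)^2 / 2)].
    The second term is bounded below through
    [|C D^T|_F <= (|D|_F^2 + rho) |C M|_F] and [|D|_F^2 = n d] almost surely. *)

(** * Frobenius norm and reflections *)

Section Frobenius.
Variable R : realFieldType.

(** The square of the norm is kept throughout, so that every estimate is polynomial; on a column it
    is the squared Euclidean length. *)
Definition fro m n (A : 'M[R]_(m, n)) : R := \sum_i \sum_j A i j ^+ 2.

Lemma fro_ge0 m n (A : 'M[R]_(m, n)) : 0 <= fro A.
Proof. by apply: sumr_ge0 => i _; apply: sumr_ge0 => j _; exact: sqr_ge0. Qed.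

Lemma fro_eq0 m n (A : 'M[R]_(m, n)) : fro A <= 0 -> A = 0.
Proof.
move=> A0; have /eqP : fro A = 0 by apply/le_anti; rewrite A0 fro_ge0.
rewrite psumr_eq0; last by move=> i _; apply: sumr_ge0 => j _; exact: sqr_ge0.
move=> /allP h; apply/matrixP => i j; rewrite mxE.
have /implyP/(_ isT) := h i (mem_index_enum i).
rewrite psumr_eq0; last by move=> k _; exact: sqr_ge0.
move=> /allP/(_ j (mem_index_enum j))/implyP/(_ isT).
by rewrite sqrf_eq0 => /eqP.
Qed.

Lemma sqr_entry_le_fro m n (A : 'M[R]_(m, n)) i j : A i j ^+ 2 <= fro A.
Proof.
rewrite /fro (bigD1 i)//= (bigD1 j)//= -addrA lerDl addr_ge0//.
  by apply: sumr_ge0 => k _; exact: sqr_ge0.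
by apply: sumr_ge0 => k _; apply: sumr_ge0 => l _; exact: sqr_ge0.
Qed.

Lemma fro_tr m n (A : 'M[R]_(m, n)) : fro A = \tr (A^T *m A).
Proof.
rewrite /fro exchange_big; apply: eq_bigr => j _.
by rewrite mxE; apply: eq_bigr => i _; rewrite mxE expr2.
Qed.

Lemma fro_trmx m n (A : 'M[R]_(m, n)) : fro A^T = fro A.
Proof.
rewrite /fro exchange_big; apply: eq_bigr => i _; apply: eq_bigr => j _.
by rewrite mxE.
Qed.

Lemma froZ m n a (A : 'M[R]_(m, n)) : fro (a *: A) = a ^+ 2 * fro A.
Proof.
rewrite /fro mulr_sumr; apply: eq_bigr => i _; rewrite mulr_sumr.
by apply: eq_bigr => j _; rewrite mxE exprMn.
Qed.

Lemma trmxD m n (A B : 'M[R]_(m, n)) : (A + B)^T = A^T + B^T.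
Proof. exact: linearD. Qed.

Lemma trmxB m n (A B : 'M[R]_(m, n)) : (A - B)^T = A^T - B^T.
Proof. exact: linearB. Qed.

Lemma froD m n (A B : 'M[R]_(m, n)) :
  fro (A + B) = fro A + 2 * \tr (A^T *m B) + fro B.
Proof.
rewrite !fro_tr trmxD mulmxDl !mulmxDr !mxtraceD.
by rewrite -(mxtrace_tr (B^T *m A)) trmx_mul trmxK; ring.
Qed.

(** Lagrange's identity: twice the difference of the two sides is the sum of the squares of
    [a i * b j - a j * b i]. *)
Lemma cauchy_schwarz_sum (I : finType) (a b : I -> R) :
  (\sum_i a i * b i) ^+ 2 <= (\sum_i a i ^+ 2) * (\sum_i b i ^+ 2).
Proof.
have : 0 <= \sum_i \sum_j (a i * b j - a j * b i) ^+ 2.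
  by apply: sumr_ge0 => i _; apply: sumr_ge0 => j _; exact: sqr_ge0.
have -> : \sum_i \sum_j (a i * b j - a j * b i) ^+ 2 =
   \sum_i \sum_j a i ^+ 2 * b j ^+ 2 + \sum_i \sum_j b i ^+ 2 * a j ^+ 2
   - 2 * \sum_i \sum_j (a i * b i) * (a j * b j).
  rewrite mulr_sumr -sumrN -!big_split/=; apply: eq_bigr => i _.
  rewrite mulr_sumr -sumrN -!big_split/=; apply: eq_bigr => j _; ring.
rewrite -!big_distrlr/= -expr2; lra.
Qed.

Lemma fro_mulmx m n p (A : 'M[R]_(m, n)) (B : 'M[R]_(n, p)) :
  fro (A *m B) <= fro A * fro B.
Proof.
rewrite /fro [X in _ * X]exchange_big big_distrlr/=.
apply: ler_sum => i _; apply: ler_sum => j _.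
by rewrite mxE; exact: cauchy_schwarz_sum.
Qed.

Lemma mxtrace_sqr_le_fro n (A : 'M[R]_n) : \sum_i A i i ^+ 2 <= fro A.
Proof.
apply: ler_sum => i _; rewrite (bigD1 i)//= lerDl.
by apply: sumr_ge0 => j _; exact: sqr_ge0.
Qed.

Definition dot n (u v : 'cV[R]_n) : R := (u^T *m v) 0 0.

Lemma dotE n (u v : 'cV[R]_n) : dot u v = \sum_i u i 0 * v i 0.
Proof. by rewrite /dot mxE; apply: eq_bigr => i _; rewrite mxE. Qed.

Lemma dot_mx n (u v : 'cV[R]_n) : u^T *m v = (dot u v)%:M.
Proof. by rewrite [LHS]mx11_scalar. Qed.

Lemma dotC n (u v : 'cV[R]_n) : dot u v = dot v u.
Proof. by rewrite !dotE; apply: eq_bigr => i _; rewrite mulrC. Qed.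

Lemma dotvv n (u : 'cV[R]_n) : dot u u = fro u.
Proof.
rewrite dotE /fro; apply: eq_bigr => i _.
by rewrite big_ord_recl big_ord0 addr0 expr2.
Qed.

Lemma dotBl n (u v w : 'cV[R]_n) : dot (u - v) w = dot u w - dot v w.
Proof. by rewrite /dot trmxB mulmxBl !mxE. Qed.

Lemma dotBr n (u v w : 'cV[R]_n) : dot w (u - v) = dot w u - dot w v.
Proof. by rewrite /dot mulmxBr !mxE. Qed.

Lemma dotDr n (u v w : 'cV[R]_n) : dot w (u + v) = dot w u + dot w v.
Proof. by rewrite /dot mulmxDr !mxE. Qed.

Lemma dotDl n (u v w : 'cV[R]_n) : dot (u + v) w = dot u w + dot v w.
Proof. by rewrite !(dotC _ w) dotDr. Qed.

Lemma dotZr n a (u v : 'cV[R]_n) : dot u (a *: v) = a * dot u v.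
Proof. by rewrite /dot -scalemxAr !mxE. Qed.

Lemma dot_mulmx n m (A : 'M[R]_(n, m)) u v : dot u (A *m v) = dot (A^T *m u) v.
Proof. by rewrite /dot trmx_mul trmxK mulmxA. Qed.

Lemma dot_delta n (u : 'cV[R]_n) i : dot (delta_mx i 0) u = u i 0.
Proof.
rewrite dotE (bigD1 i)//= mxE !eqxx mul1r big1 ?addr0// => j ji.
by rewrite mxE (negbTE ji) mul0r.
Qed.

(** The vector [C^T *m delta_mx a 0] is row [a] of [C]. Together with [dot_mulmx] this turns |C y|^2
    into a sum of squares of linear forms in y. *)
Lemma fro_cols m n (C : 'M[R]_(m, n)) :
  fro C = \sum_a fro (C^T *m (delta_mx a 0 : 'cV[R]_m)).
Proof.
apply: eq_bigr => a _; rewrite -colE /fro; apply: eq_bigr => j _.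
by rewrite big_ord_recl big_ord0 addr0 !mxE.
Qed.

Lemma fro_delta n i : fro (delta_mx i 0 : 'cV[R]_n) = 1.
Proof. by rewrite -dotvv dot_delta mxE !eqxx. Qed.

Lemma dot_orth n (Q : 'M[R]_n) u v : Q^T = Q -> Q *m Q = 1%:M ->
  dot (Q *m u) (Q *m v) = dot u v.
Proof. by move=> QT QQ; rewrite dot_mulmx QT mulmxA QQ mul1mx. Qed.

(* The Householder reflection exchanging [u] and [v]. *)
Lemma reflection n (u v : 'cV[R]_n) : fro u = fro v ->
  exists Q : 'M[R]_n, [/\ Q^T = Q, Q *m Q = 1%:M, Q *m u = v
    & forall x, dot (u - v) x = 0 -> Q *m x = x].
Proof.
move=> uv; have [->|neq] := eqVneq u v.
  by exists 1%:M; split=> [|||x _]; rewrite ?trmx1 ?mul1mx.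
set w := u - v; set s := fro w.
have s0 : s != 0.
  apply/eqP => s0; move/eqP: neq; apply; apply/eqP; rewrite -subr_eq0.
  by apply/eqP/fro_eq0; rewrite -/w -/s s0.
(* As u and v have the same length, |u - v|^2 = 2 (u - v).u; the reflection along w therefore
   subtracts exactly w from u. *)
have wu : dot w u = s / 2.
  apply: (@mulfI _ 2); first by rewrite pnatr_eq0.
  by rewrite /s -dotvv /w !dotBr !dotBl !dotvv uv (dotC v u); field.
pose Q : 'M[R]_n := 1%:M - (2 / s) *: (w *m w^T).
(* The trailing factor [z] lets one formula serve both for vectors ([z = 1]) and for the rank-one
   matrix [w *m w^T] in the proof that [Q] is an involution. *)
have Qx m x (z : 'M[R]_(1, m)) : Q *m (x *m z) = (x - (2 / s * dot w x) *: w) *m z.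
  rewrite mulmxA; congr (_ *m _); rewrite mulmxBl mul1mx -scalemxAl -mulmxA.
  rewrite dot_mx mul_mx_scalar scalerA.
  by rewrite mulrC.
have Q1 x : Q *m x = x - (2 / s * dot w x) *: w.
  by have := Qx _ x 1%:M; rewrite !mulmx1.
exists Q; split.
- by rewrite trmxB linearZ/= trmx1 trmx_mul trmxK.
- rewrite {2}/Q mulmxBr mulmx1 -scalemxAr Qx dotvv -/s.
  rewrite divfK// (_ : w - 2 *: w = - w); last first.
    by rewrite scaler_nat mulr2n opprD addNKr.
  by rewrite mulNmx scalerN opprK subrK.
- by rewrite Q1 wu [2 / s * _](_ : _ = 1) ?scale1r ?/w ?subKr//; field.
- by move=> x wx; rewrite Q1 wx mulr0 scale0r subr0.
Qed.

(** * The ridge matrix *)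

Definition ridge_mx n d (D : 'M[R]_(n, d)) (rho : R) : 'M[R]_(d, n) :=
  D^T *m invmx (D *m D^T + rho%:M).

Section ridge.
Variables (n d : nat) (D : 'M[R]_(n, d)) (rho : R).
Hypothesis rho0 : 0 < rho.
Local Notation M := (ridge_mx D rho).
Local Notation H := (M *m D).

(** A row v in the kernel satisfies |v D|^2 + rho |v|^2 = 0, so it vanishes. *)
Lemma gram_ridge_unit : D *m D^T + rho%:M \in unitmx.
Proof.
rewrite -row_free_unit; apply: inj_row_free => v v0; apply/fro_eq0.
have : \tr (v *m (D *m D^T + rho%:M) *m v^T) = 0 by rewrite v0 mul0mx mxtrace0.
rewrite mulmxDr mulmxDl mxtraceD mul_mx_scalar -scalemxAl mxtraceZ.
have -> : v *m (D *m D^T) *m v^T = (v *m D) *m (v *m D)^T.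
  by rewrite trmx_mul !mulmxA.
rewrite mxtrace_mulC -fro_tr mxtrace_mulC -fro_tr => e.
rewrite -(pmulr_rle0 _ rho0); have := fro_ge0 (v *m D); lra.
Qed.

Lemma ridge_mulr : M *m (D *m D^T + rho%:M) = D^T.
Proof. by rewrite mulmxKV// gram_ridge_unit. Qed.

(** The push-through identity (D^T D + rho) D^T = D^T (D D^T + rho) gives the normal equation of the
    d-dimensional problem from the n-dimensional inverse. *)
Lemma ridge_normal : (D^T *m D + rho%:M) *m M = D^T.
Proof.
rewrite /ridge_mx mulmxA.
have -> : (D^T *m D + rho%:M) *m D^T = D^T *m (D *m D^T + rho%:M).
  by rewrite mulmxDl mulmxDr mulmxA mul_scalar_mx mul_mx_scalar.
by rewrite mulmxK// gram_ridge_unit.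
Qed.

(** Pairing the normal equation with M gives |D M|^2 + rho |M|^2 = tr (D M), and x <= x^2 + 1/4 on
    the n diagonal entries absorbs the trace. The bound does not depend on D, so the weights are
    bounded random variables. *)
Lemma fro_ridge_le : fro M <= n%:R / (4 * rho).
Proof.
have := congr1 (fun A => \tr (M^T *m A)) ridge_normal; rewrite /= mulmxA.
rewrite mulmxDr mulmxDl mxtraceD mulmxA mul_mx_scalar -scalemxAl mxtraceZ.
rewrite -[in X in _ + X]fro_tr -mulmxA -trmx_mul -fro_tr.
rewrite mxtrace_tr => e.
have h : \tr (D *m M) <= fro (D *m M) + n%:R / 4.
  apply: (@le_trans _ _ (\sum_i ((D *m M) i i ^+ 2 + 1 / 4))).
    by apply: ler_sum => i _; have := sqr_ge0 ((D *m M) i i - 1 / 2); nra.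
  rewrite big_split/= sumr_const card_ord -(mulr_natr (1 / 4)) div1r.
  rewrite [_^-1 * _]mulrC lerD2r; exact: mxtrace_sqr_le_fro.
rewrite ler_pdivlMr ?mulr_gt0//; nra.
Qed.

Lemma ridge_hat_normal : (D^T *m D + rho%:M) *m H = D^T *m D.
Proof. by rewrite mulmxA ridge_normal. Qed.

(** For N = 1 - H one has (D^T D + rho) N = rho. Pairing with N yields |N|^2 <= tr N, and x <= (x^2
    + 1) / 2 on the d diagonal entries concludes. Again the bound is uniform in D. *)
Lemma fro_ridge_hat_le : fro (1%:M - H) <= d%:R.
Proof.
have : (D^T *m D + rho%:M) *m (1%:M - H) = rho%:M.
  by rewrite mulmxBr mulmx1 ridge_hat_normal addrAC subrr add0r.
move: (1%:M - H) => N /(congr1 (fun A => \tr (N^T *m A))); rewrite /= mulmxA.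
rewrite mulmxDr mulmxDl mxtraceD mulmxA !mul_mx_scalar -scalemxAl !mxtraceZ.
rewrite -[in X in _ + X]fro_tr -mulmxA -trmx_mul -fro_tr mxtrace_tr => e.
have h : \tr N <= fro N / 2 + d%:R / 2.
  apply: (@le_trans _ _ (\sum_i (N i i ^+ 2 / 2 + 1 / 2))).
    by apply: ler_sum => i _; have := sqr_ge0 (N i i - 1); nra.
  rewrite big_split/= sumr_const card_ord -(mulr_natr (1 / 2)) div1r.
  rewrite [X in _ + X]mulrC lerD2r.
  by rewrite -mulr_suml ler_pM2r ?invr_gt0//; exact: mxtrace_sqr_le_fro.
have : rho * fro N <= rho * \tr N by have := fro_ge0 (D *m N); lra.
rewrite ler_pM2l//; lra.
Qed.

Lemma trmx_invmx_sym m (A : 'M[R]_m) : A^T = A -> (invmx A)^T = invmx A.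
Proof. by move=> AT; rewrite trmx_inv AT. Qed.

Lemma ridge_hat_sym : H^T = H.
Proof.
rewrite /ridge_mx !trmx_mul trmxK trmx_invmx_sym ?mulmxA//.
by rewrite trmxD trmx_mul trmxK tr_scalar_mx.
Qed.

(** With B = C M one has C D^T = B (D D^T + rho). Its squared norm is |B D D^T|^2 + 2 rho |B D|^2 +
    rho^2 |B|^2, and submultiplicativity bounds these by the three terms of the expanded square on
    the right. *)
Lemma fro_le_ridge m (C : 'M[R]_(m, d)) :
  fro (C *m D^T) <= (fro D + rho) ^+ 2 * fro (C *m M).
Proof.
rewrite -ridge_mulr mulmxA; move: (C *m M) => B.
rewrite mulmxDr froD mul_mx_scalar froZ -scalemxAr mxtraceZ.
have -> : \tr ((B *m (D *m D^T))^T *m B) = fro (B *m D).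
  by rewrite fro_tr !trmx_mul trmxK -!mulmxA [LHS]mxtrace_mulC !mulmxA.
have h1 : fro (B *m D) <= fro B * fro D by exact: fro_mulmx.
have h2 : fro (B *m (D *m D^T)) <= fro B * fro D * fro D.
  rewrite mulmxA (le_trans (fro_mulmx _ _))// fro_trmx.
  by rewrite ler_wpM2r// fro_ge0.
have h3 := ler_wpM2l (ltW rho0) h1.
rewrite sqrrD; lra.
Qed.

(** At z = H theta the cross terms vanish by the normal equation, so the objective at z + y exceeds
    its value at z by |D y|^2 + rho |y|^2. A point that does no worse than z must have y = 0. *)
Lemma ridge_argmin_uniq (theta w : 'cV[R]_d) :
  fro (D *m w - D *m theta) + rho * fro w <=
  fro (D *m (H *m theta) - D *m theta) + rho * fro (H *m theta) ->
  w = H *m theta.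
Proof.
have := congr1 (mulmx^~ theta) ridge_hat_normal; rewrite /= -mulmxA.
move: (H *m theta) => z; rewrite mulmxDl mul_scalar_mx => zE hle.
apply/eqP; rewrite -subr_eq0; apply/eqP/fro_eq0.
have wE : w = z + (w - z) by rewrite addrC subrK.
move: (w - z) wE => y wE.
have nz : D^T *m (D *m z - D *m theta) + rho *: z = 0.
  by rewrite mulmxBr !mulmxA -zE opprD addrA subrr sub0r addNr.
have cross : \tr ((D *m z - D *m theta)^T *m (D *m y)) + rho * \tr (z^T *m y) = 0.
  rewrite mulmxA -(mxtraceZ rho) scalemxAl -mxtraceD -mulmxDl.
  have -> : (D *m z - D *m theta)^T *m D + rho *: z^T =
            (D^T *m (D *m z - D *m theta) + rho *: z)^T.
    by rewrite [RHS]trmxD linearZ/= [(D^T *m _)^T]trmx_mul trmxK.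
  by rewrite nz trmx0 mul0mx mxtrace0.
move: hle; rewrite wE mulmxDr addrAC !froD => hle.
have := fro_ge0 (D *m y) => h1.
rewrite -(pmulr_rle0 _ rho0); lra.
Qed.

Lemma ridge_mx_orth (Q : 'M[R]_d) : Q *m Q^T = 1%:M ->
  ridge_mx (D *m Q) rho = Q^T *m M.
Proof.
move=> QQ; rewrite /ridge_mx trmx_mul -(mulmxA D) (mulmxA Q) QQ mul1mx.
by rewrite mulmxA.
Qed.

End ridge.

(** Symmetry makes tr (H^2) the sum of all squared entries, and the half squared differences of
    diagonal entries sum to d times the sum of the [H a a ^+ 2] minus the squared trace. Each
    summand on the right is a combination of squares u^T H v with u orthogonal to v. *)
Lemma mxtrace_sqr_defect d (H : 'M[R]_d) : H^T = H ->
  d%:R * \tr (H *m H) - (\tr H) ^+ 2 =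
  \sum_a \sum_(b | b != a)
    (d%:R * H a b ^+ 2 + (H a a - H b b) ^+ 2 / 2).
Proof.
move=> HT.
have -> : \tr (H *m H) = \sum_a H a a ^+ 2 + \sum_a \sum_(b | b != a) H a b ^+ 2.
  rewrite -[X in X *m _]HT -fro_tr -big_split/=; apply: eq_bigr => a _.
  by rewrite (bigD1 a).
have -> : (\tr H) ^+ 2 = d%:R * (\sum_a H a a ^+ 2) -
    \sum_a \sum_(b | b != a) (H a a - H b b) ^+ 2 / 2.
  have -> : \sum_a \sum_(b | b != a) (H a a - H b b) ^+ 2 / 2 =
     \sum_a \sum_b ((H a a ^+ 2 + H b b ^+ 2) / 2 - H a a * H b b).
    apply: eq_bigr => a _; rewrite [RHS](bigD1 a)//= [X in X + _](_ : _ = 0).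
      by rewrite add0r; apply: eq_bigr => b _; field.
    by field.
  rewrite expr2 /mxtrace big_distrlr/=.
  have -> : d%:R * (\sum_a H a a ^+ 2) = \sum_a \sum_b (H a a ^+ 2 + H b b ^+ 2) / 2.
    under [RHS]eq_bigr do rewrite -mulr_suml big_split/= sumr_const card_ord.
    rewrite -mulr_suml big_split/= sumr_const card_ord sumrMnl.
    by rewrite -(mulr_natl (\sum_a _)); field.
  rewrite -sumrB; apply: eq_bigr => a _; rewrite -sumrB; apply: eq_bigr => b _; ring.
under [RHS]eq_bigr do rewrite big_split/= -mulr_sumr.
rewrite big_split/= -mulr_sumr; ring.
Qed.
End Frobenius.

(** * Traces from the roots of the characteristic polynomial *)

Section spectrum.
Variable R : numFieldType.

(** A nonzero polynomial has fewer roots than its size. Characteristic polynomials are compared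
    through it by determinants at infinitely many scalars. *)
Lemma poly_eq_on_inj (f : nat -> R) (p q : {poly R}) : injective f ->
  (forall k, p.[f k] = q.[f k]) -> p = q.
Proof.
move=> finj fe; apply/eqP; rewrite -subr_eq0; apply/eqP.
apply: (@roots_geq_poly_eq0 _ _ [seq f k | k <- iota 0 (size (p - q))]).
- by apply/allP => _ /mapP[k _ ->]; rewrite /root !hornerE fe subrr.
- by rewrite map_inj_uniq// iota_uniq.
- by rewrite size_map size_iota.
Qed.

Lemma horner_char_poly n (A : 'M[R]_n) x : (char_poly A).[x] = \det (x%:M - A).
Proof.
rewrite -horner_evalE -det_map_mx; congr (\det _); apply/matrixP => i j.
rewrite !mxE /= horner_evalE !hornerE; congr (_ - _).
by rewrite hornerMn hornerX.
Qed.

(** The homogenised characteristic polynomial; [y = 0] is treated apart because the scaling divides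
    by [y]. *)
Lemma det_char_poly_roots n (A : 'M[R]_n) (a : 'I_n -> R) :
  char_poly A = \prod_i ('X - (a i)%:P) ->
  forall x y, \det (x%:M - y *: A) = \prod_i (x - y * a i).
Proof.
move=> cA x y; have [->|y0] := eqVneq y 0.
  rewrite scale0r subr0 det_scalar; under eq_bigr do rewrite mul0r subr0.
  by rewrite prodr_const card_ord.
have -> : x%:M - y *: A = y *: ((x / y)%:M - A).
  by rewrite scalerBr scale_scalar_mx mulrC divfK.
rewrite detZ -horner_char_poly cA horner_prod.
rewrite -[X in _ ^+ X * _](card_ord n) -prodr_const -big_split/=.
by apply: eq_bigr => i _; rewrite !hornerE; field.
Qed.

Lemma mxtrace_char_poly_roots n (A : 'M[R]_n) (a : 'I_n -> R) :
  char_poly A = \prod_i ('X - (a i)%:P) -> \tr A = \sum_i a i.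
Proof.
case: n A a => [|n] A a cA; first by rewrite /mxtrace !big_ord0.
apply: oppr_inj; rewrite -char_poly_trace// cA.
have := @coefPn_prod_XsubC _ [seq a i | i <- index_enum 'I_n.+1].
rewrite size_map !big_map (_ : size _ = n.+1) => [->//|].
by rewrite -[RHS]size_enum_ord enumT.
Qed.

(** No diagonalisation is involved: multiplying x - K (K + rho)^-1 by K + rho leaves x rho - (1 - x)
    K, whose determinant is the product of the x rho - (1 - x) gam_i = (x - gam_i / (gam_i + rho))
    (gam_i + rho). *)
Lemma char_poly_shrink n (K : 'M[R]_n) (rho : R) (gam : 'I_n -> R) :
  K + rho%:M \in unitmx ->
  char_poly K = \prod_i ('X - (gam i)%:P) ->
  char_poly (K *m invmx (K + rho%:M)) =
    \prod_i ('X - (gam i / (gam i + rho))%:P).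
Proof.
move=> uK cK; have dK := det_char_poly_roots cK.
have detK : \det (K + rho%:M) = \prod_i (gam i + rho).
  rewrite (_ : K + _ = rho%:M - (-1) *: K) ?dK.
    by apply: eq_bigr => i _; ring.
  by rewrite scaleN1r opprK addrC.
have g0 i : gam i + rho != 0.
  move: uK; rewrite unitmxE unitfE detK => /prodf_neq0; exact.
apply: (@poly_eq_on_inj (fun k => k%:R)).
  by move=> i j /eqP; rewrite eqr_nat => /eqP.
move=> k; rewrite horner_char_poly horner_prod; set x : R := k%:R.
apply: (@mulIf _ (\det (K + rho%:M))); first by rewrite -unitfE -unitmxE.
rewrite -det_mulmx mulmxBl mulmxKV// mulmxDr -scalar_mxM mul_scalar_mx.
rewrite (_ : _ - K = (x * rho)%:M - (1 - x) *: K) ?dK.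
  rewrite detK -big_split/=; apply: eq_bigr => i _.
  by rewrite !hornerE; field.
by rewrite scalerBl scale1r opprB addrA [X in X - K]addrC.
Qed.

(** The factorisation x^2 - J^2 = (x - J) (x + J) gives equality at the squares of all naturals. *)
Lemma char_poly_sqr n (J : 'M[R]_n) (h : 'I_n -> R) :
  char_poly J = \prod_i ('X - (h i)%:P) ->
  char_poly (J *m J) = \prod_i ('X - (h i ^+ 2)%:P).
Proof.
move=> cJ; have dJ := det_char_poly_roots cJ.
apply: (@poly_eq_on_inj (fun k => k%:R ^+ 2)).
  move=> i j /eqP; rewrite eqrXn2 ?ler0n// eqr_nat; exact/eqP.
move=> k; rewrite horner_char_poly horner_prod; set x : R := k%:R.
have -> : (x ^+ 2)%:M - J *m J = (x%:M - 1 *: J) *m (x%:M - (-1) *: J).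
  rewrite scaleN1r scale1r opprK mulmxDr !mulmxBl -scalar_mxM expr2.
  by rewrite mul_mx_scalar mul_scalar_mx addrA subrK.
rewrite det_mulmx !dJ -big_split/=; apply: eq_bigr => i _.
by rewrite !hornerE; ring.
Qed.

End spectrum.

Section ridge_traces.
Variables (R : realFieldType) (n d : nat) (D : 'M[R]_(n, d)) (rho : R).
Variable gam : 'I_n -> R.
Hypothesis rho0 : 0 < rho.
Hypothesis gamE : char_poly (D *m D^T) = \prod_i ('X - (gam i)%:P).
Local Notation H := (ridge_mx D rho *m D).

Let cJ : char_poly (D *m ridge_mx D rho) =
  \prod_i ('X - (gam i / (gam i + rho))%:P).
Proof.
by rewrite /ridge_mx mulmxA; apply: char_poly_shrink => //; exact: gram_ridge_unit.
Qed.

Lemma mxtrace_ridge_hat : \tr H = \sum_i gam i / (gam i + rho).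
Proof. by rewrite mxtrace_mulC (mxtrace_char_poly_roots cJ). Qed.

Lemma mxtrace_ridge_hat_sqr :
  \tr (H *m H) = \sum_i gam i ^+ 2 / (gam i + rho) ^+ 2.
Proof.
move: (ridge_mx D rho) cJ => M cM.
have -> : \tr (M *m D *m (M *m D)) = \tr (D *m M *m (D *m M)).
  by rewrite -mulmxA mxtrace_mulC !mulmxA.
rewrite (mxtrace_char_poly_roots (char_poly_sqr cM)).
by apply: eq_bigr => i _; rewrite expr_div_n.
Qed.

End ridge_traces.

(** * Measurable and bounded families *)

(** Inversion is written as x times the real power -1 of x^2, which is measurable; the convention
    0^-1 = 0 agrees on both sides. *)
Lemma measurable_inv (R : realType) : measurable_fun [set: R] (@GRing.inv R).
Proof.
have -> : @GRing.inv R = (fun x => x * ((x ^+ 2) `^ (-1))).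
  apply/funext => x; rewrite powR_inv1 ?sqr_ge0//.
  have [->|x0] := eqVneq x 0; first by rewrite invr0 mul0r.
  by rewrite expr2 invfM mulrA divff// mul1r.
apply: measurable_funM => //.
exact: (measurableT_comp (measurable_powR _) (measurable_funX _ _)).
Qed.

Section measurable_matrix.
Context (R : realType) (dT : measure_display) (T : measurableType dT).

Definition mxmeas m n (F : T -> 'M[R]_(m, n)) :=
  forall i j, measurable_fun [set: T] (fun t => F t i j).

Lemma mxmeas_cst m n (A : 'M[R]_(m, n)) : mxmeas (fun=> A).
Proof. by move=> i j; exact: measurable_cst. Qed.

Lemma mxmeas_tr m n (F : T -> 'M[R]_(m, n)) : mxmeas F -> mxmeas (fun t => (F t)^T).
Proof. by move=> mF i j; under eq_fun do rewrite mxE; exact: mF. Qed.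

Lemma mxmeasD m n (F G : T -> 'M[R]_(m, n)) :
  mxmeas F -> mxmeas G -> mxmeas (fun t => F t + G t).
Proof.
by move=> mF mG i j; under eq_fun do rewrite mxE; exact: measurable_funD.
Qed.

Lemma mxmeasM m n p (F : T -> 'M[R]_(m, n)) (G : T -> 'M[R]_(n, p)) :
  mxmeas F -> mxmeas G -> mxmeas (fun t => F t *m G t).
Proof.
move=> mF mG i j; under eq_fun do rewrite mxE.
by apply: measurable_sum => k; exact: measurable_funM.
Qed.

Lemma measurable_det n (F : T -> 'M[R]_n) :
  mxmeas F -> measurable_fun [set: T] (fun t => \det (F t)).
Proof.
move=> mF; rewrite /determinant; apply: measurable_sum => s.
apply: measurable_funM; first exact: measurable_cst.
by apply: measurable_prod => i _; exact: mF.
Qed.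

(** Cramer's formula: the entries of the inverse are cofactors divided by the determinant, all
    polynomial in the entries of [F t]. *)
Lemma mxmeasV n (F : T -> 'M[R]_n) : (forall t, F t \in unitmx) ->
  mxmeas F -> mxmeas (fun t => invmx (F t)).
Proof.
move=> uF mF i j; under eq_fun do rewrite /invmx uF !mxE.
apply: measurable_funM.
  by apply: measurableT_comp (measurable_det mF); exact: measurable_inv.
rewrite /cofactor; apply: measurable_funM; first exact: measurable_cst.
by apply: measurable_det => k l; under eq_fun do rewrite !mxE; exact: mF.
Qed.

Lemma measurable_fro m n (F : T -> 'M[R]_(m, n)) :
  mxmeas F -> measurable_fun [set: T] (fun t => fro (F t)).
Proof.
move=> mF; do 2 apply: measurable_sum => ?.
exact: measurable_funX.
Qed.

End measurable_matrix.

Section bounded_measurable.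
Context (R : realType) (dT : measure_display) (T : measurableType dT).
Implicit Types f g : T -> R.

(** This class is closed under sums and products, integrable for every probability, and stable as a
    multiplier of integrable functions, which settles most integrability questions below. *)
Definition bmeas f :=
  measurable_fun [set: T] f /\ exists B : R, forall t, `|f t| <= B.

Lemma bmeas_cst (c : R) : bmeas (fun=> c).
Proof. by split; [exact: measurable_cst|exists `|c|]. Qed.

Lemma bmeasD f g : bmeas f -> bmeas g -> bmeas (fun t => f t + g t).
Proof.
move=> [mf [B fB]] [mg [C gC]]; split; first exact: measurable_funD.
by exists (B + C) => t; rewrite (le_trans (ler_normD _ _))// lerD.
Qed.

Lemma bmeasM f g : bmeas f -> bmeas g -> bmeas (fun t => f t * g t).
Proof.
move=> [mf [B fB]] [mg [C gC]]; split; first exact: measurable_funM.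
by exists (B * C) => t; rewrite normrM ler_pM.
Qed.

Lemma bmeasX f n : bmeas f -> bmeas (fun t => f t ^+ n).
Proof.
move=> bf; elim: n => [|n ih]; first exact: bmeas_cst.
by under eq_fun do rewrite exprS; exact: bmeasM.
Qed.

Lemma bmeasB f g : bmeas f -> bmeas g -> bmeas (fun t => f t - g t).
Proof.
move=> bf bg; have := bmeasD bf (bmeasM (bmeas_cst (-1)) bg).
by congr bmeas; apply/funext => t; rewrite mulN1r.
Qed.

Lemma bmeas_sum I (s : seq I) (p : pred I) (f : I -> T -> R) :
  (forall i, bmeas (f i)) -> bmeas (fun t => \sum_(i <- s | p i) f i t).
Proof.
move=> bf; elim: s => [|i s ih].
  by under eq_fun do rewrite big_nil; exact: bmeas_cst.
under eq_fun do rewrite big_cons.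
by case: (p i) => //; exact: bmeasD.
Qed.

Definition mxbmeas m n (F : T -> 'M[R]_(m, n)) :=
  forall i j, bmeas (fun t => F t i j).

Lemma mxbmeas_cst m n (A : 'M[R]_(m, n)) : mxbmeas (fun=> A).
Proof. by move=> i j; exact: bmeas_cst. Qed.

Lemma mxbmeas_tr m n (F : T -> 'M[R]_(m, n)) :
  mxbmeas F -> mxbmeas (fun t => (F t)^T).
Proof. by move=> mF i j; under eq_fun do rewrite mxE; exact: mF. Qed.

Lemma mxbmeasM m n p (F : T -> 'M[R]_(m, n)) (G : T -> 'M[R]_(n, p)) :
  mxbmeas F -> mxbmeas G -> mxbmeas (fun t => F t *m G t).
Proof.
move=> mF mG i j; under eq_fun do rewrite mxE.
by apply: bmeas_sum => k; exact: bmeasM.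
Qed.

Lemma bmeas_fro m n (F : T -> 'M[R]_(m, n)) :
  mxbmeas F -> bmeas (fun t => fro (F t)).
Proof.
move=> mF; do 2 apply: bmeas_sum => ?.
exact: bmeasX.
Qed.

Lemma bmeas_integrable (P : probability T R) f :
  bmeas f -> P.-integrable [set: T] (EFin \o f).
Proof.
move=> [mf [B fB]]; apply: measurable_bounded_integrable => //.
  exact: (le_lt_trans (probability_le1 P measurableT) (ltry 1)).
by exists B; split; [exact: num_real|move=> x /ltW Bx t _ /=; exact: le_trans Bx].
Qed.

Lemma integrable_bmeasM (P : probability T R) f g :
  P.-integrable [set: T] (EFin \o f) -> bmeas g ->
  P.-integrable [set: T] (EFin \o (fun t => f t * g t)).
Proof.
move=> fi [mg [B gB]].
have := @integrableMr _ _ _ P setT measurableT g (EFin \o f) mg _ fi.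
rewrite (_ : EFin \o (fun t => (f t * g t)%R) = (EFin \o g) \* (EFin \o f))%E; last first.
  by apply/funext => t /=; rewrite mulrC.
apply; exists B; split; first exact: num_real.
by move=> x /ltW Bx t _ /=; exact: le_trans Bx.
Qed.

Lemma RintegralE (P : probability T R) f : P.-integrable [set: T] (EFin \o f) ->
  (\int[P]_t (f t)%:E = (\int[P]_t f t)%:E)%E.
Proof. by move=> fi; rewrite /Rintegral fineK//; exact: integrable_fin_num. Qed.

Lemma integrable_addR (P : probability T R) f g :
  P.-integrable [set: T] (EFin \o f) -> P.-integrable [set: T] (EFin \o g) ->
  P.-integrable [set: T] (EFin \o (fun t => f t + g t)).
Proof.
by move=> fi gi; have := integrableD measurableT fi gi; apply: eq_integrable.
Qed.

Lemma integrable_sumR (P : probability T R) (I : finType) (p : pred I)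
    (f : I -> T -> R) :
  (forall i, P.-integrable [set: T] (EFin \o f i)) ->
  P.-integrable [set: T] (EFin \o (fun t => \sum_(i | p i) f i t)).
Proof.
move=> fi; have := @integrable_sum _ _ _ P setT measurableT I (index_enum I) p
  (fun i t => (f i t)%:E) (fun i _ => fi i).
by congr (integrable _ _ _); apply/funext => t /=; rewrite sumEFin.
Qed.

Lemma Rintegral_sum (P : probability T R) (I : finType) (p : pred I)
    (f : I -> T -> R) :
  (forall i, P.-integrable [set: T] (EFin \o f i)) ->
  \int[P]_t (\sum_(i | p i) f i t) = \sum_(i | p i) \int[P]_t f i t.
Proof.
move=> fi; apply: EFin_inj; rewrite -RintegralE; last exact: integrable_sumR.
under eq_integral do rewrite -sumEFin.
rewrite integral_sum//.
by rewrite -sumEFin; apply: eq_bigr => i _; rewrite RintegralE.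
Qed.

End bounded_measurable.

(** * Laws and conditional expectations *)

Lemma ge0_integral_same_law (R : realType) d1 d2 dT (T1 : measurableType d1)
    (T2 : measurableType d2) (T : measurableType dT)
    (P1 : {measure set T1 -> \bar R}) (P2 : {measure set T2 -> \bar R})
    (Z1 : T1 -> T) (Z2 : T2 -> T) (f : T -> \bar R) :
  measurable_fun [set: T1] Z1 -> measurable_fun [set: T2] Z2 ->
  (forall A, measurable A -> P1 (Z1 @^-1` A) = P2 (Z2 @^-1` A)) ->
  measurable_fun [set: T] f -> (forall t, 0 <= f t)%E ->
  (\int[P1]_w f (Z1 w) = \int[P2]_w f (Z2 w))%E.
Proof.
move=> mZ1 mZ2 Z12 mf f0.
have := @ge0_integral_pushforward _ _ _ _ _ _ mZ1 P1 setT f measurableT mf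
  (fun t _ => f0 t); rewrite preimage_setT => <-.
have := @ge0_integral_pushforward _ _ _ _ _ _ mZ2 P2 setT f measurableT mf
  (fun t _ => f0 t); rewrite preimage_setT => <-.
by apply: eq_measure_integral => A mA _; exact: Z12.
Qed.

Section same_tuple_law.
Context (R : realType) (dO dT : measure_display) (Omega : measurableType dO)
  (T : measurableType dT) (P : probability Omega R) (n : nat).

Let box := [set B : set (n.-tuple T) | exists2 A : 'I_n -> set T,
  (forall i, measurable (A i)) &
  B = \bigcap_(i in [set: 'I_n]) ((fun t => tnth t i) @^-1` A i)].

Let box_generates : @measurable _ (n.-tuple T) = <<s box >>.
Proof.
apply/seteqP; split.
  apply: smallest_sub; first exact: smallest_sigma_algebra.
  rewrite -bigcup_seq => B [i _ [A mA <-]]; apply: sub_sigma_algebra.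
  exists (fun j => if j == i then A else setT).
    by move=> j; case: ifP.
  apply/seteqP; split => [t [_ At] j _ /=|t /(_ i Logic.I)/=].
    by case: eqP => // ->.
  by rewrite eqxx.
apply: smallest_sub; first exact: sigma_algebra_measurable.
move=> _ [A mA ->]; apply: fin_bigcap_measurable => // i _.
by rewrite -[X in measurable X]setTI; exact: measurable_tnth.
Qed.

(** Boxes are stable under intersection and generate the product sigma-algebra, so two finite
    measures of equal mass that agree on them coincide. *)
Lemma same_tuple_law (X X' : 'I_n -> Omega -> T) :
  (forall i, measurable_fun [set: Omega] (X i)) ->
  (forall i, measurable_fun [set: Omega] (X' i)) ->
  (forall A : 'I_n -> set T, (forall i, measurable (A i)) ->
    P (\bigcap_(i in [set: 'I_n]) (X i @^-1` A i)) =
    P (\bigcap_(i in [set: 'I_n]) (X' i @^-1` A i))) ->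
  forall B, measurable B ->
    P ((fun w => [tuple X i w | i < n]) @^-1` B) =
    P ((fun w => [tuple X' i w | i < n]) @^-1` B).
Proof.
move=> mX mX' XX' B mB.
have mt (Y : 'I_n -> Omega -> T) : (forall i, measurable_fun [set: Omega] (Y i)) ->
    measurable_fun [set: Omega] (fun w => [tuple Y i w | i < n]).
  move=> mY; apply/measurable_fun_tnthP => i.
  by rewrite (_ : _ \o _ = Y i)//; apply/funext => w /=; rewrite tnth_mktuple.
have mZ := mt _ mX; have mZ' := mt _ mX'.
apply: (@measure_unique _ R (n.-tuple T) box (fun=> setT) box_generates _ _ _
  (pushforward P (fun w => [tuple X i w | i < n]))
  (pushforward P (fun w => [tuple X' i w | i < n])) _ _ B mB) => //=.
- move=> _ _ [A mA ->] [A' mA' ->]; exists (fun i => A i `&` A' i).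
    by move=> i; exact: measurableI.
  apply/seteqP; split => [t [At A't] i _|t At]; first by split; [exact: At|exact: A't].
  by split => i _; have [] := At i Logic.I.
- move=> _; exists (fun=> setT) => //.
  by apply/seteqP; split.
- by apply/seteqP; split => // t _; exists 0%N.
- move=> _ [A mA ->]; have := XX' _ mA; rewrite /pushforward.
  by congr (P _ = P _); apply/seteqP; split => w Aw i _; have := Aw i Logic.I;
    rewrite /= tnth_mktuple.
- by move=> _; rewrite /pushforward preimage_setT probability_setT ltry.
Qed.

End same_tuple_law.

Lemma Rintegral_dominated_cvg (R : realType) dO (Omega : measurableType dO)
    (P : probability Omega R) (xi : Omega -> R) (B : R) (g_ : nat -> Omega -> R)
    (g : Omega -> R) :
  P.-integrable [set: Omega] (EFin \o xi) ->
  (forall k, measurable_fun [set: Omega] (g_ k)) ->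
  (forall k w, `|g_ k w| <= B) -> (forall w, g_ ^~ w @ \oo --> g w) ->
  bmeas g ->
  (fun k => \int[P]_w (xi w * g_ k w)) @ \oo --> \int[P]_w (xi w * g w).
Proof.
move=> ixi mg gB gg bgl.
have mxi : measurable_fun [set: Omega] xi.
  by case/integrableP : ixi => /measurable_EFinP.
have bg k : bmeas (g_ k) by split => //; exists B.
have cg w : (fun k => (xi w * g_ k w)%:E) @ \oo --> (xi w * g w)%:E.
  apply: cvg_EFin; first exact: nearW.
  by apply: cvgM; [exact: cvg_cst|exact: gg].
have mf k : measurable_fun [set: Omega] (fun w => (xi w * g_ k w)%:E).
  by apply/measurable_EFinP; exact: measurable_funM.
have dom k w : [set: Omega] w -> (`|(xi w * g_ k w)%:E| <= (`|xi w| * B)%:E)%E.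
  by move=> _; rewrite /= lee_fin normrM ler_wpM2l.
have idom : P.-integrable [set: Omega] (fun w => (`|xi w| * B)%:E).
  apply: (@integrable_bmeasM _ _ _ P (fun w => `|xi w|) (fun=> B)); last exact: bmeas_cst.
  exact: integrable_norm ixi.
have := @dominated_cvg _ _ _ P setT measurableT
  (fun k w => (xi w * g_ k w)%:E) (fun w => (xi w * g w)%:E)
  (fun w => (`|xi w| * B)%:E) mf (fun w _ => cg w)
  (fun _ _ => isT) idom dom.
rewrite RintegralE; last exact: integrable_bmeasM.
by move=> /fine_cvgP[_].
Qed.

Section cond_exp_const.
Context (R : realType) (dO dT : measure_display) (Omega : measurableType dO)
  (T : measurableType dT) (P : probability Omega R).
Variables (Z : Omega -> T) (xi : Omega -> R) (c : R).
Hypothesis mZ : measurable_fun [set: Omega] Z.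
Hypothesis cZ : cond_exp_const P Z xi c.

Lemma bmeas_comp (g : T -> R) : bmeas g -> bmeas (g \o Z).
Proof.
by move=> [mg [B gB]]; split; [exact: measurableT_comp|exists B => t; exact: gB].
Qed.

Lemma bmeas_indic (A : set T) : measurable A -> bmeas (\1_A : T -> R).
Proof.
move=> mA; split; first exact: measurable_indic.
by exists 1 => t; rewrite indicE; case: (_ \in _); rewrite ?normr1 ?normr0.
Qed.

Let int_xi (g : T -> R) : bmeas g ->
  P.-integrable [set: Omega] (EFin \o (fun w => xi w * g (Z w))).
Proof. by move=> bg; apply: integrable_bmeasM cZ.1 (bmeas_comp bg). Qed.

Let int_Z (g : T -> R) : bmeas g ->
  P.-integrable [set: Omega] (EFin \o (fun w => g (Z w))).
Proof. by move=> bg; exact: bmeas_integrable (bmeas_comp bg). Qed.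

Let cond_exp_indic (A : set T) : measurable A ->
  \int[P]_w (xi w * \1_A (Z w)) = c * \int[P]_w \1_A (Z w).
Proof.
move=> mA; have mZA : measurable (Z @^-1` A) by rewrite -[X in measurable X]setTI; exact: mZ.
apply: EFin_inj; rewrite EFinM -!RintegralE; last 2 first.
- exact: int_Z (bmeas_indic mA).
- exact: int_xi (bmeas_indic mA).
rewrite -[X in (_ * X)%E](_ : P (Z @^-1` A) = _); last first.
  by rewrite -[Z @^-1` A]setIT -integral_indic.
rewrite -cZ.2// [RHS]integral_mkcond; apply: eq_integral => w _.
rewrite /patch indicE (_ : (w \in _ @^-1` _) = (Z w \in A))//.
by case: ifP => _; rewrite ?mulr1 ?mulr0.
Qed.

Import HBNNSimple.

Let cond_exp_nnsfun (h : {nnsfun T >-> R}) :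
  \int[P]_w (xi w * h (Z w)) = c * \int[P]_w h (Z w).
Proof.
pose s : seq R := finmap.enum_fset (fset_set (range h)).
pose A i := h @^-1` [set s`_i].
have mA i : measurable (A i) by exact: measurable_sfunP.
have hE t : h t = \sum_(i < size s) s`_i * \1_(A i) t by exact: fimfunEord.
have -> : (fun w => xi w * h (Z w)) =
    (fun w => \sum_(i < size s) s`_i * (xi w * \1_(A i) (Z w))).
  apply/funext => w; rewrite hE mulr_sumr; apply: eq_bigr => i _.
  by rewrite mulrCA.
have -> : (fun w => h (Z w)) =
    (fun w => \sum_(i < size s) s`_i * \1_(A i) (Z w)).
  by apply/funext => w; rewrite hE.
have bA i := bmeas_indic (mA i).
rewrite !Rintegral_sum; last 2 first.
- move=> i; apply: bmeas_integrable; apply: bmeasM; first exact: bmeas_cst.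
  exact: bmeas_comp.
- move=> i; have := int_xi (bmeasM (bmeas_cst T s`_i) (bA i)).
  by congr (integrable _ _ _); apply/funext => w /=; rewrite mulrCA.
rewrite mulr_sumr; apply: eq_bigr => i _.
rewrite !RintegralZl//; [|exact: int_Z|exact: int_xi].
by rewrite cond_exp_indic// mulrCA.
Qed.

Let cond_exp_ge0 (g : T -> R) : bmeas g -> (forall t, 0 <= g t) ->
  \int[P]_w (xi w * g (Z w)) = c * \int[P]_w g (Z w).
Proof.
move=> bg g0; case: (bg) => mg [B gB].
have mEg : measurable_fun [set: T] (EFin \o g) by exact/measurable_EFinP.
have [h [hnd hg]] := @approximation _ _ R setT measurableT (EFin \o g)
  mEg (fun t _ => g0 t).
have {}hg t : (fun k => h k t) @ \oo --> g t.
  by have /fine_cvgP[_] := hg t Logic.I.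
have hB k t : `|h k t| <= B.
  rewrite ger0_norm//; apply: le_trans (le_trans (ler_norm _) (gB t)).
  rewrite -(cvg_lim _ (hg t))//; apply: (@nondecreasing_cvgn_le _ (fun k => h k t)).
    by move=> a b ab; have /lefP := hnd _ _ ab; exact.
  by apply/cvg_ex; exists (g t).
have mh k : measurable_fun [set: Omega] (fun w => h k (Z w)) by exact: measurableT_comp.
have lim1 := Rintegral_dominated_cvg cZ.1 mh (fun k w => hB k (Z w))
  (fun w => hg (Z w)) (bmeas_comp bg).
(* The same limit theorem with the constant 1 in place of [xi] handles the right-hand side. *)
have i1 : P.-integrable [set: Omega] (EFin \o (fun=> 1 : R)).
  exact/bmeas_integrable/bmeas_cst.
have lim2 := Rintegral_dominated_cvg i1 mh (fun k w => hB k (Z w))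
  (fun w => hg (Z w)) (bmeas_comp bg).
have {lim1}lim1 : (fun k => c * \int[P]_w (1 * h k (Z w))) @ \oo -->
    \int[P]_w (xi w * g (Z w)).
  apply: cvg_trans lim1; apply: near_eq_cvg; apply: nearW => k.
  rewrite cond_exp_nnsfun; congr (c * _); congr (Rintegral _ _ _).
  by apply/funext => w; rewrite mul1r.
have := cvg_unique _ lim1 (cvgM (cvg_cst c) lim2) => ->//.
congr (c * _); congr (Rintegral _ _ _).
by apply/funext => w /=; rewrite mul1r.
Qed.

(** The definition of [cond_exp_const] gives the case of indicators; linearity extends it to simple
    functions, and dominated convergence to bounded nonnegative ones. A general [g] bounded by B is
    reached through g + B and the constant B. *)
Lemma cond_exp_const_mul (g : T -> R) : bmeas g ->
  \int[P]_w (xi w * g (Z w)) = c * \int[P]_w g (Z w).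
Proof.
move=> bg; case: (bg) => mg [B gB].
have bB := bmeas_cst T B.
have gB0 t : 0 <= g t + B by have := gB t; rewrite ler_norml; lra.
have B0 : 0 <= B by rewrite (le_trans _ (gB point)).
have := cond_exp_ge0 (bmeasD bg bB) gB0.
under eq_Rintegral do rewrite mulrDr.
rewrite (RintegralD _ (int_xi bg) (int_xi bB))//.
rewrite (RintegralD _ (int_Z bg) (int_Z bB))//.
rewrite (cond_exp_ge0 bB (fun=> B0)) mulrDr.
exact: addIr.
Qed.

End cond_exp_const.

(** * The sphere and the group average *)

Section euclidean.
Context (R : realType) (d : nat).
Implicit Types x y : d.-tuple R.

Definition cvt x : 'cV[R]_d := \col_i tnth x i.

Lemma dotv_cvt x y : dotv x y = dot (cvt x) (cvt y).
Proof. by rewrite dotE; apply: eq_bigr => i _; rewrite !mxE. Qed.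

Lemma cvt_actv (M : 'M[R]_d) x : cvt (actv M x) = M *m cvt x.
Proof.
apply/matrixP => i j; rewrite !mxE tnth_mktuple; apply: eq_bigr => k _.
by rewrite mxE.
Qed.

Lemma mxmeas_cvt : mxmeas cvt.
Proof.
by move=> i j; under eq_fun do rewrite mxE; exact: measurable_tnth.
Qed.

Lemma measurable_actv (M : 'M[R]_d) : measurable_fun [set: d.-tuple R] (actv M).
Proof.
apply/measurable_fun_tnthP => i.
have := mxmeasM (mxmeas_cst (T:=d.-tuple R) M) mxmeas_cvt i 0.
by congr measurable_fun; apply/funext => x /=; rewrite -cvt_actv mxE.
Qed.

Lemma measurable_dot dT (T : measurableType dT) (F G : T -> 'cV[R]_d) :
  mxmeas F -> mxmeas G -> measurable_fun [set: T] (fun t => dot (F t) (G t)).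
Proof. by move=> mF mG; exact: (mxmeasM (mxmeas_tr mF) mG). Qed.

Lemma measurable_sphere : measurable (@sphere R d).
Proof.
have -> : @sphere R d = (fun x => dot (cvt x) (cvt x)) @^-1` [set d%:R].
  by apply/seteqP; split => x /=; rewrite /sphere /= dotv_cvt.
rewrite -[X in measurable X]setTI; apply: measurable_dot => //; exact: mxmeas_cvt.
Qed.

Lemma sphere_fro x : @sphere R d x -> fro (cvt x) = d%:R.
Proof. by rewrite /sphere/= dotv_cvt dotvv. Qed.

End euclidean.

Section uniform_sphere.
Context (R : realType) (d : nat) (mu : probability (d.-tuple R) R).
Hypothesis hmu : uniform_on_sphere mu.
Hypothesis d0 : (0 < d)%N.

Lemma uniform_sphereC : mu (~` @sphere R d) = 0%E.
Proof.
by rewrite probability_setC ?hmu.1 ?subee//; exact: measurable_sphere.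
Qed.

Let F (u : 'cV[R]_d) : \bar R := (\int[mu]_x ((dot u (cvt x)) ^+ 2)%:E)%E.

Let mF (u : 'cV[R]_d) :
  measurable_fun [set: d.-tuple R] (fun x => ((dot u (cvt x)) ^+ 2)%:E).
Proof.
apply/measurable_EFinP; apply: measurable_funX; apply: measurable_dot.
  exact: mxmeas_cst.
exact: mxmeas_cvt.
Qed.

Let F_orth (Q : 'M[R]_d) u : Q^T = Q -> Q *m Q = 1%:M -> F (Q *m u) = F u.
Proof.
move=> QT QQ; have oQ : orthogonal_mx Q by rewrite /orthogonal_mx QT.
have := @ge0_integral_same_law R _ _ _ _ _ _ mu mu (actv Q) id
  (fun x => ((dot u (cvt x)) ^+ 2)%:E) (measurable_actv Q) (@measurable_id _ _ _)
  (fun A mA => hmu.2 Q oQ A mA) (mF u) (fun x => sqr_ge0 _).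
rewrite /F => <-; apply: eq_integral => x _.
by rewrite cvt_actv dot_mulmx QT.
Qed.

Let e0 : 'cV[R]_d := delta_mx (Ordinal d0) 0.

(** A reflection carries u to |u| times the first basis vector, and [F] is invariant under
    reflections and quadratic under scaling. *)
Let F_e0 u : F u = ((fro u)%:E * F e0)%E.
Proof.
have : fro u = fro (Num.sqrt (fro u) *: e0).
  by rewrite froZ fro_delta mulr1 sqr_sqrtr// fro_ge0.
move=> /reflection[Q [QT QQ Qu _]]; rewrite -(F_orth u QT QQ) Qu.
rewrite /F -ge0_integralZl//; first last.
- by rewrite lee_fin fro_ge0.
- by move=> x _; rewrite lee_fin sqr_ge0.
apply: eq_integral => x _.
by rewrite dotC dotZr exprMn sqr_sqrtr ?fro_ge0// dotC EFinM.
Qed.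

Let sum_F : (\sum_(i < d) F (delta_mx i 0%R) = d%:R%:E)%E.
Proof.
rewrite /F -ge0_integral_sum//; last by move=> i x _; rewrite lee_fin sqr_ge0.
have -> : (d%:R%:E = \int[mu]_x (cst d%:R%:E x))%E.
  by rewrite integral_cst//= probability_setT mule1.
apply: ge0_ae_eq_integral => //.
- apply: emeasurable_sum => i; exact: mF.
- by move=> x _; apply: sume_ge0 => i _; rewrite lee_fin sqr_ge0.
- by move=> x _; rewrite lee_fin.
exists (~` (@sphere R d)); split.
- by apply: measurableC; exact: measurable_sphere.
- exact: uniform_sphereC.
apply: subsetC => x sx _ /=; rewrite sumEFin -(sphere_fro sx) -dotvv dotE.
by congr (_%:E); apply: eq_bigr => i _; rewrite dot_delta expr2.
Qed.

(** By invariance the moment is c |u|^2. Summing over the coordinate basis integrates |x|^2 = d, so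
    d c = d; that finite sum also excludes an infinite c. *)
Lemma sphere_second_moment u : F u = (fro u)%:E.
Proof.
have F1 : F e0 = 1%E.
  have := sum_F; under eq_bigr do rewrite F_e0 fro_delta mul1e.
  have : (0 <= F e0)%E by apply: integral_ge0 => x _; rewrite lee_fin sqr_ge0.
  case: (F e0) => [r _|_|//].
    rewrite sumEFin sumr_const card_ord => -[] /eqP.
    rewrite -(mulr_natl r) -{2}(mulr1 d%:R) => /eqP/mulfI -> //.
    by rewrite pnatr_eq0 -lt0n.
  by rewrite (bigD1 (Ordinal d0))//= addye// gt_eqF// (lt_le_trans ltNy0)// sume_ge0.
by rewrite F_e0 F1 mule1.
Qed.

End uniform_sphere.

Section has_law_sphere.
Context (R : realType) (d : nat) (mu : probability (d.-tuple R) R)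
  (dO : measure_display) (Omega : measurableType dO) (P : probability Omega R)
  (Z : Omega -> d.-tuple R).
Hypothesis hmu : uniform_on_sphere mu.
Hypothesis hZ : has_law P Z mu.

Lemma ae_has_law_sphere : {ae P, forall w, @sphere R d (Z w)}.
Proof.
exists (Z @^-1` (~` @sphere R d)); split => //.
- rewrite -[X in measurable X]setTI; apply: hZ.1 => //.
  by apply: measurableC; exact: measurable_sphere.
- apply: etrans (uniform_sphereC hmu); apply: hZ.2.
  by apply: measurableC; exact: measurable_sphere.
Qed.

Lemma measurable_dot_cvt (u : 'cV[R]_d) :
  measurable_fun [set: Omega] (fun w => dot u (cvt (Z w))).
Proof.
apply: measurable_dot; first exact: mxmeas_cst.
by move=> i j; exact: (measurableT_comp (@mxmeas_cvt R d i j) hZ.1).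
Qed.

Lemma has_law_second_moment (u : 'cV[R]_d) : (0 < d)%N ->
  (\int[P]_w ((dot u (cvt (Z w))) ^+ 2)%:E = (fro u)%:E)%E.
Proof.
move=> d0; rewrite -(sphere_second_moment hmu d0).
apply: (@ge0_integral_same_law R _ _ _ _ _ _ P mu Z id
  (fun x => ((dot u (cvt x)) ^+ 2)%:E)) => //.
- exact: hZ.1.
- exact: hZ.2.
- apply/measurable_EFinP; apply: measurable_funX; apply: measurable_dot.
    exact: mxmeas_cst.
  exact: mxmeas_cvt.
- by move=> x; rewrite lee_fin sqr_ge0.
Qed.

End has_law_sphere.

Section haar.
Context (R : realType) (d : nat) (G : ptopologicalType) (mul : G -> G -> G)
  (inv : G -> G) (e : G) (lam : probability (BorelG G) R) (phi : G -> 'M[R]_d).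
Hypothesis hG : topological_group mul inv e.
Hypothesis hlam : haar_probability mul lam.
Hypothesis hphi : measurable_orth_rep mul e phi.
Local Notation Phi := (avg_mx lam phi).

Let mphi i j : bmeas (fun g : BorelG G => phi g i j).
Proof.
case: hphi => _ _ ophi mphi; split; first exact: mphi.
exists (d%:R + 1) => g.
have : phi g i j ^+ 2 <= d%:R.
  rewrite (le_trans (sqr_entry_le_fro _ _ _))// fro_tr.
  by rewrite (ophi g : _ *m _ = _) mxtrace_scalar.
have : 0 <= d%:R :> R by [].
by rewrite ler_norml; nra.
Qed.

Let iphi i j := bmeas_integrable lam (mphi i j).

Lemma avgO_dot (v : 'cV[R]_d) x :
  avgO lam phi (fun z => dot v (cvt z)) x = dot v (Phi *m cvt x).
Proof.
rewrite /avgO dotE.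
transitivity (\int[lam]_g (\sum_i \sum_j (v i 0 * cvt x j 0) * phi g i j)).
  apply: eq_Rintegral => g _; rewrite dotE; apply: eq_bigr => i _.
  rewrite cvt_actv mxE mulr_sumr; apply: eq_bigr => j _.
  by rewrite (mulrC (phi g i j)) mulrA.
have b1 i j : bmeas (fun g : BorelG G => (v i 0 * cvt x j 0) * phi g i j).
  by apply: bmeasM; [exact: bmeas_cst|exact: mphi].
rewrite Rintegral_sum; last first.
  by move=> i; apply: bmeas_integrable; exact: bmeas_sum.
apply: eq_bigr => i _; rewrite Rintegral_sum; last first.
  by move=> j; exact: bmeas_integrable.
rewrite mxE mulr_sumr; apply: eq_bigr => j _.
by rewrite RintegralZl// [in RHS]mxE mulrA mulrAC.
Qed.

Let mul_inv g : mul g (inv g) = e.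
Proof.
case: hG => mA m1 mV _ _.
by rewrite -[LHS]m1 -[X in mul X _](mV (inv g)) -mA (mA (inv g)) mV m1.
Qed.

Let measurable_translate g : measurable_fun [set: BorelG G] (mul g : BorelG G -> BorelG G).
Proof.
case: hG => _ _ _ cmul _.
apply: (@measurability _ _ (BorelG G) (BorelG G) setT (mul g) (@open G)) => //.
move=> _ [U oU <-]; rewrite setTI; apply: sub_sigma_algebra.
apply: open_comp oU => h _.
apply: (@continuous_comp _ _ _ (fun h => (g, h)) (fun p => mul p.1 p.2)); last exact: cmul.
by apply: cvg_pair => /=; [exact: cvg_cst|exact: cvg_id].
Qed.

(** Haar invariance is stated for images of translations, whereas the change of variables below
    involves preimages. *)
Let translate_preimage g (A : set G) : mul g @^-1` A = [set mul (inv g) a | a in A].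
Proof.
case: hG => mA m1 mV _ _; apply/seteqP; split => [h Ah|_ [a Aa <-] /=].
  by exists (mul g h) => //; rewrite mA mV m1.
by rewrite mA mul_inv m1.
Qed.

Let phi_avg g : phi g *m Phi = Phi.
Proof.
case: hphi => _ phiM _ _; apply/matrixP => i j; rewrite !mxE.
have mt := measurable_translate g.
have ic : lam.-integrable setT ((EFin \o (fun h : BorelG G => phi h i j)) \o mul g).
  apply: (@bmeas_integrable _ _ _ lam (fun h : BorelG G => phi (mul g h) i j)).
  exact: (bmeas_comp mt (mphi i j)).
transitivity (\int[lam]_h phi (mul g h) i j); last first.
  rewrite /Rintegral; congr fine.
  have /measurable_EFinP mE := (mphi i j).1.
  have := @integral_pushforward _ _ _ _ _ _ mt lam setT _ mE ic measurableT.
  rewrite preimage_setT => <-; apply: eq_measure_integral => A mA _.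
  by rewrite -[RHS](hlam (inv g) mA) -translate_preimage.
under [RHS]eq_Rintegral do rewrite phiM mxE.
rewrite Rintegral_sum; last first.
  move=> k; apply: bmeas_integrable; apply: bmeasM; [exact: bmeas_cst|exact: mphi].
by apply: eq_bigr => k _; rewrite mxE RintegralZl.
Qed.

(** As [phi g] is orthogonal, phi(g) Phi = Phi gives phi(g)^T Phi = Phi; integrating over g yields
    the claim. Symmetry and idempotence both follow from it. *)
Lemma avg_mx_tr_mul : Phi^T *m Phi = Phi.
Proof.
apply/matrixP => i j.
have -> : Phi i j = \int[lam]_g Phi i j.
  by rewrite Rintegral_cst//= probability_setT mulr1.
transitivity (\int[lam]_g (((phi g)^T *m Phi) i j)).
  under [RHS]eq_Rintegral do rewrite mxE.
  rewrite mxE Rintegral_sum; last first.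
    move=> k; under eq_fun do rewrite mxE.
    apply: bmeas_integrable; apply: bmeasM; [exact: mphi|exact: bmeas_cst].
  apply: eq_bigr => k _; under [RHS]eq_Rintegral do rewrite mxE.
  by rewrite RintegralZr// !mxE.
apply: eq_Rintegral => g _; case: hphi => _ _ ophi _.
by rewrite -{1}(phi_avg g) mulmxA (ophi g : _ *m _ = _) mul1mx.
Qed.

Lemma avg_mx_sym : Phi^T = Phi.
Proof. by rewrite -[in LHS]avg_mx_tr_mul trmx_mul trmxK avg_mx_tr_mul. Qed.

Lemma avg_mx_idem : Phi *m Phi = Phi.
Proof. by rewrite -{1}avg_mx_sym avg_mx_tr_mul. Qed.

Lemma avg_mx_invariant (theta : 'cV[R]_d) :
  (forall g x, dot theta (phi g *m x) = dot theta x) -> Phi *m theta = theta.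
Proof.
move=> inv_theta; rewrite -avg_mx_sym.
have hg g : (phi g)^T *m theta = theta.
  apply/matrixP => i k; rewrite [k]ord1 -[LHS]dot_delta -[RHS]dot_delta.
  by rewrite dotC -dot_mulmx inv_theta dotC.
apply/matrixP => i k; rewrite [k]ord1 mxE.
have -> : theta i 0 = \int[lam]_g theta i 0.
  by rewrite Rintegral_cst//= probability_setT mulr1.
transitivity (\int[lam]_g (((phi g)^T *m theta) i 0)); last first.
  by apply: eq_Rintegral => g _; rewrite hg.
under [RHS]eq_Rintegral do rewrite mxE.
rewrite Rintegral_sum; last first.
  move=> l; under eq_fun do rewrite mxE.
  apply: bmeas_integrable; apply: bmeasM; [exact: mphi|exact: bmeas_cst].
apply: eq_bigr => l _; under [RHS]eq_Rintegral do rewrite mxE.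
by rewrite RintegralZr// !mxE.
Qed.

End haar.

(** * Moments of the sample *)

Section design.
Context (R : realType) (n d : nat).
Local Notation sample := (n.-tuple (d.-tuple R)).

Definition design (t : sample) : 'M[R]_(n, d) := \matrix_(i, j) tnth (tnth t i) j.

Lemma mxmeas_design : mxmeas design.
Proof.
move=> i j; under eq_fun do rewrite mxE.
exact: (measurableT_comp (measurable_tnth j) (measurable_tnth i)).
Qed.

Lemma fro_design t : fro (design t) = \sum_i fro (cvt (tnth t i)).
Proof.
apply: eq_bigr => i _; apply: eq_bigr => j _.
by rewrite big_ord_recl big_ord0 addr0 !mxE.
Qed.

Lemma design_actv (Q : 'M[R]_d) t :
  design [tuple actv Q (tnth t i) | i < n] = design t *m Q^T.
Proof.
apply/matrixP => i j; rewrite !mxE tnth_mktuple tnth_mktuple.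
by apply: eq_bigr => k _; rewrite !mxE mulrC.
Qed.

Lemma gram_design t : gram (fun i => tnth t i) = design t *m (design t)^T.
Proof.
by apply/matrixP => i j; rewrite !mxE; apply: eq_bigr => k _; rewrite !mxE.
Qed.

Variable rho : R.
Hypothesis rho0 : 0 < rho.

Definition weight (t : sample) : 'M[R]_(d, n) := ridge_mx (design t) rho.
Definition hat (t : sample) : 'M[R]_d := weight t *m design t.

Let bounded_entries m k (F : sample -> 'M[R]_(m, k)) (B : R) :
  mxmeas F -> (forall t, fro (F t) <= B) -> mxbmeas F.
Proof.
move=> mF FB i j; split; first exact: mF.
exists (B + 1) => t; have := le_trans (sqr_entry_le_fro (F t) i j) (FB t).
have := le_trans (fro_ge0 (F t)) (FB t).
by rewrite ler_norml; nra.
Qed.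

Lemma mxbmeas_weight : mxbmeas weight.
Proof.
apply: bounded_entries (fun t => fro_ridge_le (design t) rho0).
apply: mxmeasM; first exact: mxmeas_tr mxmeas_design.
apply: mxmeasV; first by move=> t; exact: gram_ridge_unit.
apply: mxmeasD; last exact: mxmeas_cst.
by apply: mxmeasM; [|apply: mxmeas_tr]; exact: mxmeas_design.
Qed.

Lemma mxbmeas_hat : mxbmeas hat.
Proof.
have h : mxbmeas (fun t => 1%:M - hat t).
  apply: bounded_entries (fun t => fro_ridge_hat_le (design t) rho0).
  move=> i j; under eq_fun do rewrite mxE [X in _ + X]mxE.
  apply: measurable_funB; first exact: measurable_cst.
  apply: mxmeasM => [k l|]; [exact: (mxbmeas_weight k l).1|exact: mxmeas_design].
move=> i j; have := bmeasB (bmeas_cst sample ((1%:M : 'M[R]_d) i j)) (h i j).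
congr bmeas; apply/funext => t.
by rewrite [(1%:M - hat t) i j]mxE [(- hat t) i j]mxE opprB addrC subrK.
Qed.

Lemma hat_sym t : (hat t)^T = hat t.
Proof. exact: ridge_hat_sym. Qed.

Lemma hat_actv (Q : 'M[R]_d) t : Q^T = Q -> Q *m Q = 1%:M ->
  hat [tuple actv Q (tnth t i) | i < n] = Q *m hat t *m Q.
Proof.
move=> QT QQ; rewrite /hat /weight design_actv QT ridge_mx_orth ?QT//.
by rewrite !mulmxA.
Qed.

End design.

Section sample.
Context (R : realType) (n d : nat) (dO : measure_display)
  (Omega : measurableType dO) (P : probability Omega R)
  (mu : probability (d.-tuple R) R) (X : 'I_n -> Omega -> d.-tuple R) (rho : R).
Hypothesis hd : (1 < d)%N.
Hypothesis rho0 : 0 < rho.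
Hypothesis hmu : uniform_on_sphere mu.
Hypothesis hX : forall i, has_law P (X i) mu.
Hypothesis indX : mutually_independent P X.

Local Notation smp w := [tuple X i w | i < n].
Local Notation H w := (hat rho (smp w)).
Local Notation M w := (weight rho (smp w)).

Lemma measurable_sample : measurable_fun [set: Omega] (fun w => smp w).
Proof.
apply/measurable_fun_tnthP => i; have := (hX i).1.
by congr measurable_fun; apply/funext => w /=; rewrite tnth_mktuple.
Qed.

Let mS := measurable_sample.

(** By independence the law of the sample on a box is the product of the marginals, each of which is
    invariant under [Q]; [same_tuple_law] extends this to all measurable sets. *)
Let sample_orth (Q : 'M[R]_d) (f : n.-tuple (d.-tuple R) -> R) :
  orthogonal_mx Q -> measurable_fun setT f -> (forall t, 0 <= f t) ->
  \int[P]_w f [tuple actv Q (tnth (smp w) i) | i < n] = \int[P]_w f (smp w).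
Proof.
move=> oQ mf f0; rewrite /Rintegral; congr fine.
have mX i := (hX i).1.
have mQX i : measurable_fun [set: Omega] (fun w => actv Q (X i w)).
  exact: (measurableT_comp (measurable_actv Q) (mX i)).
have mQS : measurable_fun [set: Omega] (fun w => [tuple actv Q (X i w) | i < n]).
  apply/measurable_fun_tnthP => i; have := mQX i.
  by congr measurable_fun; apply/funext => w /=; rewrite tnth_mktuple.
transitivity (\int[P]_w (f [tuple actv Q (X i w) | i < n])%:E)%E.
  apply: eq_integral => w _; congr (f _)%:E.
  by apply: eq_from_tnth => i; rewrite !tnth_mktuple.
apply: (@ge0_integral_same_law R _ _ _ _ _ _ P P
  (fun w => [tuple actv Q (X i w) | i < n]) (fun w => smp w)
  (fun t => (f t)%:E)) => //; last exact/measurable_EFinP.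
apply: same_tuple_law => // A mA.
have mQA i : measurable (actv Q @^-1` A i).
  by rewrite -[X in measurable X]setTI; exact: measurable_actv.
rewrite (indX mA); apply: etrans (indX mQA) _.
apply: eq_bigr => i _.
by rewrite (hX i).2// (hX i).2// hmu.2.
Qed.

Let F (u v : 'cV[R]_d) := \int[P]_w (dot u (H w *m v)) ^+ 2.

Let bF (u v : 'cV[R]_d) :
  bmeas (fun t : n.-tuple (d.-tuple R) => (dot u (hat rho t *m v)) ^+ 2).
Proof.
apply: bmeasX; rewrite /dot; apply: (mxbmeasM (mxbmeas_cst _ u^T)).
by apply: mxbmeasM; [exact: mxbmeas_hat|exact: mxbmeas_cst].
Qed.

Let F_orth (Q : 'M[R]_d) u v : Q^T = Q -> Q *m Q = 1%:M ->
  F (Q *m u) (Q *m v) = F u v.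
Proof.
move=> QT QQ; have oQ : orthogonal_mx Q by rewrite /orthogonal_mx QT.
rewrite /F -(sample_orth oQ (bF u v).1); last by move=> t; exact: sqr_ge0.
apply: eq_Rintegral => w _; rewrite hat_actv//; congr (_ ^+ 2).
by rewrite -!mulmxA [RHS]dot_mulmx QT.
Qed.

Let FZ a b u v : F (a *: u) (b *: v) = a ^+ 2 * b ^+ 2 * F u v.
Proof.
rewrite /F -RintegralZl//; last first.
  exact: bmeas_integrable (bmeas_comp mS (bF u v)).
apply: eq_Rintegral => w _.
by rewrite -scalemxAr dotZr dotC dotZr dotC; ring.
Qed.

Let o0 : 'I_d := Ordinal (ltnW hd).
Let o1 : 'I_d := Ordinal hd.
Local Notation dlt i := (@delta_mx R d 1 i 0).
Let beta := F (dlt o0) (dlt o1).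

(** One reflection sends u to r e_0. A second sends the image of v to s e_1 and fixes e_0, because
    both of these vectors are orthogonal to e_0. Conjugation invariance of [F] and homogeneity then
    leave [beta]. *)
Let F_perp u v : dot u v = 0 -> F u v = beta * fro u * fro v.
Proof.
move=> uv; set r := Num.sqrt (fro u); set s := Num.sqrt (fro v).
have r2 : r ^+ 2 = fro u by rewrite sqr_sqrtr// fro_ge0.
have s2 : s ^+ 2 = fro v by rewrite sqr_sqrtr// fro_ge0.
(* The case u = 0 is separated because orthogonality to e_0 is obtained below by cancelling r; a
   zero v fits the general argument. *)
have [r0|r0] := eqVneq r 0.
  have u0 : u = 0 by apply: fro_eq0; rewrite -r2 r0 expr0n.
  have -> : u = 0 *: u by rewrite u0 scaler0.
  by rewrite -[v]scale1r FZ froZ !expr0n/= !mul0r mulr0 mul0r.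
have : fro u = fro (r *: dlt o0) by rewrite froZ fro_delta mulr1.
move=> /reflection[Q [QT QQ Qu _]].
have fQv : fro (Q *m v) = fro (s *: dlt o1).
  by rewrite froZ fro_delta mulr1 s2 -!dotvv dot_orth.
have [Q' [Q'T Q'Q' Q'v fixQ']] := reflection fQv.
have Q'0 : Q' *m dlt o0 = dlt o0.
  apply: fixQ'; apply: (@mulfI _ r) => //; rewrite mulr0 dotBl mulrBr.
  rewrite -dotZr -Qu dot_orth// dotC uv dotC dotZr dot_delta mxE.
  by rewrite mulr0 mulr0 subr0.
rewrite -(F_orth u v QT QQ) Qu -(F_orth _ _ Q'T Q'Q') Q'v -scalemxAr Q'0 FZ r2 s2.
by rewrite -/beta; ring.
Qed.

Lemma mxbmeas_hat_sample : mxbmeas (fun w => H w).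
Proof. by move=> i j; exact: (bmeas_comp mS (@mxbmeas_hat R n d rho rho0 i j)). Qed.

Lemma mxbmeas_weight_sample : mxbmeas (fun w => M w).
Proof. by move=> i j; exact: (bmeas_comp mS (@mxbmeas_weight R n d rho rho0 i j)). Qed.

Let iF u v : P.-integrable [set: Omega] (EFin \o (fun w => (dot u (H w *m v)) ^+ 2)).
Proof. exact: bmeas_integrable (bmeas_comp mS (bF u v)). Qed.

(** The squared norm splits along the rows of [C], and [C *m theta = 0] says that every row is
    orthogonal to [theta], so [F_perp] applies to each. *)
Let hat_energy (C : 'M[R]_d) (theta : 'cV[R]_d) : C *m theta = 0 ->
  \int[P]_w fro (C *m (H w *m theta)) = beta * fro theta * fro C.
Proof.
move=> C0.
transitivity (\int[P]_w \sum_a (dot (C^T *m dlt a) (H w *m theta)) ^+ 2).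
  apply: eq_Rintegral => w _; apply: eq_bigr => a _.
  by rewrite big_ord_recl big_ord0 addr0 -dot_mulmx dot_delta.
rewrite Rintegral_sum//.
transitivity (\sum_a beta * fro (C^T *m dlt a) * fro theta).
  by apply: eq_bigr => a _; apply: F_perp; rewrite -dot_mulmx C0 dot_delta mxE.
by rewrite -mulr_suml -mulr_sumr mulrAC -fro_cols.
Qed.

(** Each ordered pair of distinct indices contributes d beta from the off-diagonal entry and (1/2) *
    2 * 2 * beta from the diagonal difference, and there are d (d - 1) such pairs. *)
Let hat_trace_defect :
  d%:R * (\int[P]_w \tr (H w *m H w)) - \int[P]_w (\tr (H w)) ^+ 2 =
  d%:R * (d%:R + 2) * (d%:R - 1) * beta.
Proof.
have bH := mxbmeas_hat_sample.
have bT : bmeas (fun w => \tr (H w *m H w)).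
  by apply: bmeas_sum => i; exact: mxbmeasM.
have bT2 : bmeas (fun w => (\tr (H w)) ^+ 2).
  by apply: bmeasX; apply: bmeas_sum => i; exact: bH.
rewrite -RintegralZl//; last exact: bmeas_integrable.
rewrite -RintegralB//; last 2 first.
- by apply: bmeas_integrable; apply: bmeasM => //; exact: bmeas_cst.
- exact: bmeas_integrable.
(* By symmetry of [H w], the difference of two diagonal entries equals (e_a + e_b)^T H (e_a - e_b),
   a form in two orthogonal vectors of squared length 2. *)
pose f a b w := d%:R * (dot (dlt a) (H w *m dlt b)) ^+ 2 +
  2^-1 * (dot (dlt a + dlt b) (H w *m (dlt a - dlt b))) ^+ 2.
have bFw u v : bmeas (fun w => (dot u (H w *m v)) ^+ 2).
  exact: (bmeas_comp mS (bF u v)).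
have bf a b : bmeas (f a b).
  by apply: bmeasD; apply: bmeasM => //; exact: bmeas_cst.
transitivity (\int[P]_w (\sum_a \sum_(b | b != a) f a b w)).
  apply: eq_Rintegral => w _; rewrite mxtrace_sqr_defect ?hat_sym//.
  apply: eq_bigr => a _; apply: eq_bigr => b _; rewrite /f.
  have HE i j : dot (dlt i) (H w *m dlt j) = H w i j.
    by rewrite dot_delta -colE mxE.
  have Hba : H w b a = H w a b by rewrite -[in LHS](hat_sym rho (smp w)) mxE.
  rewrite mulmxBr dotBr !dotDl !HE Hba.
  by congr (_ + _); rewrite mulrC; congr (_ * _); ring.
rewrite Rintegral_sum; last first.
  by move=> a; apply: bmeas_integrable; apply: bmeas_sum => b; exact: bf.
transitivity (\sum_(a < d) \sum_(b | b != a) (d%:R + 2) * beta).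
  apply: eq_bigr => a _; rewrite Rintegral_sum; last first.
    by move=> b; exact: bmeas_integrable.
  apply: eq_bigr => b ba; rewrite /f RintegralD//; last 2 first.
  - by apply: bmeas_integrable; apply: bmeasM => //; exact: bmeas_cst.
  - by apply: bmeas_integrable; apply: bmeasM => //; exact: bmeas_cst.
  rewrite !RintegralZl//.
  have dab : dot (dlt a) (dlt b) = 0 by rewrite dot_delta mxE eq_sym (negbTE ba).
  have dba : dot (dlt b) (dlt a) = 0 by rewrite dotC.
  rewrite -[X in d%:R * X]/(F _ _) -[X in 2^-1 * X]/(F _ _).
  rewrite !F_perp//; last first.
    by rewrite dotBr !dotDl !dotvv !fro_delta dab dba; ring.
  have -> : fro (dlt a + dlt b) = 2.
    by rewrite -dotvv dotDr !dotDl !dotvv !fro_delta dab dba; ring.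
  have -> : fro (dlt a - dlt b) = 2.
    by rewrite -dotvv dotBr !dotBl !dotvv !fro_delta dab dba; ring.
  by rewrite !fro_delta; field.
rewrite (eq_bigr (fun=> (d%:R - 1) * ((d%:R + 2) * beta))); last first.
  move=> a _; rewrite sumr_const cardC1 card_ord -[LHS]mulr_natl.
  by congr (_ * _); rewrite -subn1 natrB// ltnW.
by rewrite sumr_const card_ord -[LHS]mulr_natl; ring.
Qed.

Lemma hat_second_moment (C : 'M[R]_d) (theta : 'cV[R]_d) : C *m theta = 0 ->
  \int[P]_w fro (C *m (H w *m theta)) =
  fro theta * (d%:R * (\int[P]_w \tr (H w *m H w)) -
     \int[P]_w (\tr (H w)) ^+ 2) * fro C / (d%:R * (d%:R + 2) * (d%:R - 1)).
Proof.
move=> C0; rewrite hat_energy// hat_trace_defect.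
have d1 : d%:R - 1 != 0 :> R by rewrite subr_eq0 pnatr_eq1 gtn_eqF.
have d2 : d%:R + 2 != 0 :> R by rewrite gt_eqF// ltr_wpDl.
have d3 : d%:R != 0 :> R by rewrite pnatr_eq0 -lt0n ltnW.
by field; rewrite d1 d2 d3.
Qed.

Lemma ae_sample_sphere : {ae P, forall w, forall i, @sphere R d (X i w)}.
Proof. by apply: filter_forall => i; exact: (ae_has_law_sphere hmu (hX i)). Qed.

(** Integrates [fro_le_ridge]. Almost surely all sample points lie on the sphere, so its factor is
    the constant [k], and E |C D^T|^2 = n |C|^2 because every point has identity second-moment
    matrix. *)
Lemma weight_second_moment_ge (C : 'M[R]_d) :
  n%:R * fro C / (d%:R * n%:R + rho) ^+ 2 <= \int[P]_w fro (C *m M w).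
Proof.
set k := (_ + rho) ^+ 2.
have k0 : 0 < k by rewrite exprn_gt0// ltr_wpDl// mulr_ge0.
have bCM : bmeas (fun w => fro (C *m M w)).
  apply: bmeas_fro; apply: mxbmeasM; first exact: mxbmeas_cst.
  exact: mxbmeas_weight_sample.
have mdes : mxmeas (fun w => C *m (design (smp w))^T).
  apply: mxmeasM; first exact: mxmeas_cst.
  apply: mxmeas_tr => i j; exact: (measurableT_comp (mxmeas_design i j) mS).
rewrite -lee_fin -RintegralE; last exact: bmeas_integrable.
have -> : ((n%:R * fro C / k)%:E =
    \int[P]_w (k^-1%:E * (fro (C *m (design (smp w))^T))%:E))%E.
  rewrite ge0_integralZl//; last 3 first.
  - by apply/measurable_EFinP; exact: measurable_fro.
  - by move=> w _; rewrite lee_fin fro_ge0.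
  - by rewrite lee_fin invr_ge0 ltW.
  rewrite mulrC EFinM; congr (_ * _)%E.
  transitivity (\int[P]_w \sum_(a < d) \sum_(i < n)
      ((dot (C^T *m dlt a) (cvt (X i w))) ^+ 2)%:E)%E; last first.
    apply: eq_integral => w _; rewrite -sumEFin; apply: eq_bigr => a _.
    rewrite -sumEFin; apply: eq_bigr => i _; rewrite -dot_mulmx dot_delta !mxE.
    by congr (_ ^+ 2)%:E; apply: eq_bigr => j _; rewrite !mxE tnth_mktuple.
  have mdot a i : measurable_fun [set: Omega]
      (fun w => ((dot (C^T *m dlt a) (cvt (X i w))) ^+ 2)%:E).
    apply/measurable_EFinP; apply: measurable_funX.
    exact: measurable_dot_cvt (hX i) _.
  rewrite ge0_integral_sum//; last 2 first.
  - by move=> a; apply: emeasurable_sum.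
  - by move=> a w _; apply: sume_ge0 => i _; rewrite lee_fin sqr_ge0.
  transitivity (\sum_(a < d) \sum_(i < n) (fro (C^T *m dlt a))%:E)%E; last first.
    apply: eq_bigr => a _; rewrite ge0_integral_sum//; last first.
      by move=> i w _; rewrite lee_fin sqr_ge0.
    by apply: eq_bigr => i _; rewrite (has_law_second_moment hmu (hX i) _ (ltnW hd)).
  under [RHS]eq_bigr do rewrite sumEFin.
  rewrite sumEFin (fro_cols C) mulr_sumr; congr (_%:E); apply: eq_bigr => a _.
  by rewrite sumr_const card_ord mulr_natl.
apply: ae_ge0_le_integral => //.
- by move=> w _; rewrite mule_ge0// lee_fin ?invr_ge0 ?fro_ge0// ltW.
- apply: emeasurable_funM; first exact: measurable_cst.
  by apply/measurable_EFinP; exact: measurable_fro.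
- by move=> w _; rewrite lee_fin fro_ge0.
- by apply/measurable_EFinP; exact: bCM.1.
apply: filterS ae_sample_sphere => w Xw _.
rewrite -EFinM lee_fin mulrC ler_pdivrMr// mulrC.
rewrite (le_trans (fro_le_ridge (design (smp w)) rho0 C))//.
rewrite ler_wpM2r ?fro_ge0// /k (_ : fro _ = d%:R * n%:R)//.
rewrite fro_design (eq_bigr (fun=> d%:R)).
  by rewrite sumr_const card_ord -[LHS]mulr_natr.
by move=> i _; rewrite tnth_mktuple; exact: sphere_fro.
Qed.
End sample.

(** * Risk and noise *)

Lemma projection_pythagoras (R : realFieldType) n (Phi : 'M[R]_n) (y : 'cV[R]_n) :
  Phi^T = Phi -> Phi *m Phi = Phi ->
  fro y = fro (Phi *m y) + fro ((1%:M - Phi) *m y).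
Proof.
move=> PT PP; have {1}-> : y = Phi *m y + (1%:M - Phi) *m y.
  by rewrite -mulmxDl addrC subrK mul1mx.
rewrite froD trmx_mul PT mulmxA -(mulmxA _ Phi) mulmxBr mulmx1 PP subrr.
by rewrite mulmx0 mul0mx mxtrace0 mulr0 addr0.
Qed.

Lemma fro_projectionC (R : realFieldType) n (Phi : 'M[R]_n) :
  Phi^T = Phi -> Phi *m Phi = Phi -> fro (1%:M - Phi) = n%:R - fro Phi.
Proof.
move=> PT PP; rewrite !fro_tr trmxB trmx1 PT PP mulmxBl mul1mx mulmxBr mulmx1 PP.
by rewrite subrr subr0 linearB/= mxtrace_scalar.
Qed.

Section linear_risk.
Context (R : realType) (d : nat) (mu : probability (d.-tuple R) R)
  (dT : measure_display) (OmegaT : measurableType dT) (Q : probability OmegaT R)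
  (Xt : OmegaT -> d.-tuple R) (xit : OmegaT -> R).
Hypothesis d0 : (0 < d)%N.
Hypothesis hmu : uniform_on_sphere mu.
Hypothesis hXt : has_law Q Xt mu.
Hypothesis hxitm : measurable_fun [set: OmegaT] xit.
Hypothesis hcondt : cond_exp_const Q Xt xit 0.
Hypothesis hxit2 : Q.-integrable [set: OmegaT] (fun w => (xit w ^+ 2)%:E) /\
           (\int[Q]_w (xit w ^+ 2)%:E = 1)%E.

Let ae_sphere := ae_has_law_sphere hmu hXt.

(* [dot u] cut off outside the sphere, so that it is bounded. *)
Let g (u : 'cV[R]_d) (x : d.-tuple R) : R := dot u (cvt x) * \1_(@sphere R d) x.

Let bg u : bmeas (g u).
Proof.
split.
  apply: measurable_funM; last by apply: measurable_indic; exact: measurable_sphere.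
  by apply: measurable_dot; [exact: mxmeas_cst|exact: mxmeas_cvt].
exists (fro u * d%:R + 1) => x; rewrite /g indicE.
have := fro_ge0 u => u0; have : 0 <= d%:R :> R by [].
case: (boolP (x \in _)) => [|_ d0']; rewrite ?mulr0 ?normr0 ?addr_ge0 ?mulr_ge0//.
rewrite inE mulr1 => /sphere_fro xd _.
have : dot u (cvt x) ^+ 2 <= fro u * d%:R.
  rewrite -xd -(fro_trmx u); apply: le_trans (fro_mulmx _ _).
  exact: (sqr_entry_le_fro (u^T *m cvt x) 0 0).
by rewrite ler_norml; nra.
Qed.

(** Expanding the square leaves the second moment |u|^2, a cross term killed by the conditional
    mean, and the noise variance 1. The cut-off [g u] replaces the linear form almost surely, which
    makes the cross term integrable. *)
Lemma linear_risk (u : 'cV[R]_d) :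
  (\int[Q]_w ((dot u (cvt (Xt w)) - xit w) ^+ 2)%:E = (fro u + 1)%:E)%E.
Proof.
have bgX := bmeas_comp hXt.1 (bg u).
have mdot := measurable_dot_cvt hXt u.
have i1 : Q.-integrable [set: OmegaT] (EFin \o (fun w => g u (Xt w) ^+ 2)).
  exact: bmeas_integrable (bmeasX 2 bgX).
have i2 : Q.-integrable [set: OmegaT] (EFin \o (fun w => xit w * g u (Xt w))).
  exact: integrable_bmeasM hcondt.1 bgX.
have i3 : Q.-integrable [set: OmegaT] (EFin \o (fun w => xit w ^+ 2)) by exact: hxit2.1.
have i2' : Q.-integrable [set: OmegaT] (EFin \o (fun w => - 2 * (xit w * g u (Xt w)))).
  have := integrable_bmeasM i2 (bmeas_cst OmegaT (- 2)).
  by congr (integrable _ _ _); apply/funext => w /=; rewrite mulrC.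
have i12 := integrable_addR i1 i2'; have i123 := integrable_addR i12 i3.
transitivity (\int[Q]_w (g u (Xt w) ^+ 2 + - 2 * (xit w * g u (Xt w)) + xit w ^+ 2)%:E)%E.
  apply: ae_eq_integral => //.
  - by apply/measurable_EFinP; apply: measurable_funX; exact: measurable_funB.
  - by case/integrableP : i123.
  apply: filterS ae_sphere => w sw _ /=; congr (_%:E).
  by rewrite /g indicE mem_set// mulr1; ring.
rewrite RintegralE// RintegralD// RintegralD// RintegralZl//.
rewrite (cond_exp_const_mul hXt.1 hcondt (bg u)) mul0r mulr0 addr0.
congr (_%:E); congr (_ + _); last by rewrite /Rintegral hxit2.2.
apply: EFin_inj; rewrite -RintegralE//.
transitivity (\int[Q]_w ((dot u (cvt (Xt w))) ^+ 2)%:E)%E.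
  apply: ae_eq_integral => //.
  - by case/integrableP : i1.
  - by apply/measurable_EFinP; exact: measurable_funX.
  apply: filterS ae_sphere => w sw _ /=; congr (_%:E).
  by rewrite /g indicE mem_set// mulr1.
exact: (has_law_second_moment hmu hXt u d0).
Qed.

End linear_risk.

Lemma integral_fro_sphere (R : realType) (d : nat) (mu : probability (d.-tuple R) R)
    (C : 'M[R]_d) : (0 < d)%N -> uniform_on_sphere mu ->
  (\int[mu]_x (fro (C *m cvt x))%:E = (fro C)%:E)%E.
Proof.
move=> d0 hmu.
transitivity (\int[mu]_x \sum_(a < d)
    ((dot (C^T *m delta_mx a ord0) (cvt x)) ^+ 2)%:E)%E.
  apply: eq_integral => x _; rewrite -sumEFin; apply: eq_bigr => a _.
  by rewrite big_ord_recl big_ord0 addr0 -dot_mulmx dot_delta.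
rewrite ge0_integral_sum//; last 2 first.
- move=> a; apply/measurable_EFinP; apply: measurable_funX; apply: measurable_dot.
    exact: mxmeas_cst.
  exact: mxmeas_cvt.
- by move=> a x _; rewrite lee_fin sqr_ge0.
under eq_bigr do rewrite sphere_second_moment//.
by rewrite sumEFin -fro_cols.
Qed.

(** Both sides are linear in y, so a nonzero y may be rescaled to length sqrt d, where the
    invariance is assumed. *)
Lemma invariant_on_sphere (R : realType) (d : nat) (A : 'M[R]_d) (theta : d.-tuple R) :
  (forall x, @sphere R d x -> dotv theta (actv A x) = dotv theta x) ->
  forall y, dot (cvt theta) (A *m y) = dot (cvt theta) y.
Proof.
move=> inv y; have [->|y0] := eqVneq y 0; first by rewrite mulmx0.
have fy : 0 < fro y.
  by rewrite lt_def fro_ge0 andbT; apply: contra_neq y0 => fy; apply: fro_eq0; rewrite fy.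
have [d0|d0] := posnP d.
  move: (y0); have -> : y = 0; last by rewrite eqxx.
  by apply/matrixP => -[i i_lt]; exfalso; move: i_lt; rewrite d0.
pose r := Num.sqrt (d%:R / fro y).
have r2 : r ^+ 2 = d%:R / fro y by rewrite sqr_sqrtr// divr_ge0// fro_ge0.
have r0 : r != 0.
  by apply/eqP => r0; move: r2; rewrite r0 expr0n/= => /esym/eqP;
    rewrite mulf_eq0 invr_eq0 (gt_eqF fy) orbF pnatr_eq0 eqn0Ngt d0.
pose x := [tuple r * y i 0 | i < d].
have xE : cvt x = r *: y.
  by apply/matrixP => i j; rewrite !mxE tnth_mktuple [j]ord1.
have : @sphere R d x.
  by rewrite /sphere/= dotv_cvt dotvv xE froZ r2 divfK// gt_eqF.
move=> /inv; rewrite !dotv_cvt cvt_actv xE -scalemxAr !dotZr.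
exact: mulfI.
Qed.

Section noise.
Context (R : realType) (dO dT : measure_display) (Omega : measurableType dO)
  (T : measurableType dT) (P : probability Omega R) (n m : nat).
Variables (Z : Omega -> T) (xi : 'I_n -> Omega -> R).
Hypothesis mZ : measurable_fun [set: Omega] Z.
Hypothesis hcond1 : forall i, cond_exp_const P Z (xi i) 0.
Hypothesis hcond2 : forall i j,
  cond_exp_const P Z (fun w => xi i w * xi j w) (if i == j then 1 else 0).
Variables (a : T -> 'cV[R]_m) (B : T -> 'M[R]_(m, n)).
Hypothesis ba : mxbmeas a.
Hypothesis bB : mxbmeas B.
Local Notation noise w := (\col_i xi i w).

Let cross i t := (2 *: ((a t)^T *m B t)) 0 i.
Let quad i j t := ((B t)^T *m B t) i j.

Let b_cross i : bmeas (cross i).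
Proof.
rewrite /cross; under eq_fun do rewrite mxE; apply: bmeasM; first exact: bmeas_cst.
by apply: mxbmeasM => //; exact: mxbmeas_tr.
Qed.

Let b_quad i j : bmeas (quad i j).
Proof. by apply: mxbmeasM => //; exact: mxbmeas_tr. Qed.

Let energyE w : fro (a (Z w) + B (Z w) *m noise w) =
  fro (a (Z w)) + \sum_i xi i w * cross i (Z w) +
  \sum_i \sum_j (xi i w * xi j w) * quad i j (Z w).
Proof.
rewrite froD; congr (_ + _ + _).
  rewrite mulmxA [X in \tr X]mx11_scalar mxtrace_scalar mulr1n mxE mulr_sumr.
  by apply: eq_bigr => i _; rewrite /cross !mxE; ring.
rewrite fro_tr trmx_mul -mulmxA [X in \tr X]mx11_scalar mxtrace_scalar mulr1n mxE.
apply: eq_bigr => i _; rewrite mulmxA !mxE mulr_sumr; apply: eq_bigr => j _.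
by rewrite /quad !mxE; ring.
Qed.

Let i_a : P.-integrable [set: Omega] (EFin \o (fun w => fro (a (Z w)))).
Proof. exact: bmeas_integrable (bmeas_comp mZ (bmeas_fro ba)). Qed.

Let i_cross i : P.-integrable [set: Omega] (EFin \o (fun w => xi i w * cross i (Z w))).
Proof. exact: integrable_bmeasM (hcond1 i).1 (bmeas_comp mZ (b_cross i)). Qed.

Let i_quad i j :
  P.-integrable [set: Omega] (EFin \o (fun w => (xi i w * xi j w) * quad i j (Z w))).
Proof. exact: integrable_bmeasM (hcond2 i j).1 (bmeas_comp mZ (b_quad i j)). Qed.

Let i_acr := integrable_addR i_a (integrable_sumR xpredT i_cross).
Let i_qd := integrable_sumR xpredT (fun i => integrable_sumR xpredT (i_quad i)).

Lemma integrable_noise_energy :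
  P.-integrable [set: Omega] (EFin \o (fun w => fro (a (Z w) + B (Z w) *m noise w))).
Proof.
by apply: eq_integrable (integrable_addR i_acr i_qd) => // w _ /=; rewrite energyE.
Qed.

(** The terms linear in the noise and the products of distinct noises integrate to zero against
    functions of [Z]; the diagonal products leave the trace of B^T B. *)
Lemma noise_energy :
  \int[P]_w fro (a (Z w) + B (Z w) *m noise w) =
  \int[P]_w fro (a (Z w)) + \int[P]_w fro (B (Z w)).
Proof.
under eq_Rintegral do rewrite energyE.
rewrite RintegralD// RintegralD//; last exact: integrable_sumR.
rewrite -addrA; congr (_ + _).
rewrite Rintegral_sum// big1 ?add0r => [|i _]; last first.
  by rewrite (cond_exp_const_mul mZ (hcond1 i) (b_cross i)) mul0r.
rewrite Rintegral_sum; last by move=> i; exact: integrable_sumR.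
transitivity (\sum_i \int[P]_w quad i i (Z w)).
  apply: eq_bigr => i _; rewrite Rintegral_sum// (bigD1 i)//= big1 ?addr0 => [|j ji].
    by rewrite (cond_exp_const_mul mZ (hcond2 i i) (b_quad i i)) eqxx mul1r.
  rewrite (cond_exp_const_mul mZ (hcond2 i j) (b_quad i j)) eq_sym.
  by rewrite (negbTE ji) mul0r.
rewrite -Rintegral_sum; last first.
  by move=> i; exact: bmeas_integrable (bmeas_comp mZ (b_quad i i)).
by apply: eq_Rintegral => w _; rewrite fro_tr.
Qed.

End noise.

(** * Kernel ridge regression and the ridge minimiser in matrix form *)

Section sample_of_family.
Context (R : realType) (n d : nat) (X : 'I_n -> d.-tuple R) (rho : R).
Local Notation t := [tuple X i | i < n].

Lemma gram_sample : gram X = design t *m (design t)^T.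
Proof.
by rewrite -gram_design; congr gram; apply/funext => i; rewrite tnth_mktuple.
Qed.

Lemma design_cvt x : design t *m cvt x = \col_i dotv (X i) x.
Proof.
apply/matrixP => i j; rewrite !mxE; apply: eq_bigr => k _.
by rewrite !mxE tnth_mktuple.
Qed.

Lemma krr_weight (Y : 'I_n -> R) x :
  krr X Y rho x = dot (weight rho t *m \col_i Y i) (cvt x).
Proof.
rewrite dotC /dot /krr /weight /ridge_mx gram_sample !mulmxA -trmx_mul design_cvt.
by congr ((_ *m _ *m _) 0 0); apply/matrixP => i j; rewrite !mxE.
Qed.

Lemma ridge_obj_fro (theta w : d.-tuple R) :
  ridge_obj X (fun x => dotv theta x) rho w =
  fro (design t *m cvt w - design t *m cvt theta) + rho * fro (cvt w).
Proof.
rewrite /ridge_obj dotv_cvt dotvv; congr (_ + _).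
apply: eq_bigr => i _; rewrite big_ord_recl big_ord0 addr0 !design_cvt !mxE.
by rewrite !dotv_cvt !(dotC (cvt (X i))).
Qed.

Lemma ridge_min_hat (theta w : d.-tuple R) : 0 < rho ->
  ridge_min X (fun x => dotv theta x) rho w -> cvt w = hat rho t *m cvt theta.
Proof.
move=> rho0 wmin.
pose z := [tuple (hat rho t *m cvt theta) i 0 | i < d].
have zE : cvt z = hat rho t *m cvt theta.
  by apply/matrixP => i j; rewrite mxE tnth_mktuple [j]ord1.
have := wmin z; rewrite !ridge_obj_fro zE; exact: ridge_argmin_uniq.
Qed.

End sample_of_family.

(** * The risk gap and the meaning of its two terms *)

Theorem theorem5p12
  (R : realType) (d n : nat) (hd : (1 < d)%N) (hn : (0 < n)%N)
  (* the compact group G with Haar probability lambda *)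
  (G : ptopologicalType) (mul : G -> G -> G) (inv : G -> G) (e : G)
  (hG : topological_group mul inv e) (hGc : compact_sc_hausdorff G)
  (lam : probability (BorelG G) R) (hlam : haar_probability mul lam)
  (* measurable orthogonal representation *)
  (phi : G -> 'M[R]_d) (hphi : measurable_orth_rep mul e phi)
  (* uniform distribution on the sphere S_{d-1}(sqrt d) *)
  (mu : probability (d.-tuple R) R) (hmu : uniform_on_sphere mu)
  (* target f*(x) = theta^T x, G-invariant on the sphere *)
  (theta : d.-tuple R)
  (hinv : forall (g : G) (x : d.-tuple R), @sphere R d x ->
            dotv theta (actv (phi g) x) = dotv theta x)
  (* training sample on a probability space (Omega, P) *)
  (dO : measure_display) (Omega : measurableType dO) (P : probability Omega R)
  (X : 'I_n -> Omega -> d.-tuple R) (xi : 'I_n -> Omega -> R)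
  (hXlaw : forall i, has_law P (X i) mu)
  (hxim : forall i, measurable_fun [set: Omega] (xi i))
  (hind : mutually_independent P (fun i w => (X i w, xi i w)))
  (hid : identically_distributed P (fun i w => (X i w, xi i w)))
  (hcond1 : forall i,
     cond_exp_const P (fun w => [tuple X j w | j < n]) (xi i) 0)
  (hcond2 : forall i j,
     cond_exp_const P (fun w => [tuple X k w | k < n])
       (fun w => xi i w * xi j w) (if i == j then 1 else 0))
  (* test pair (X, Y = f*(X) + xi) on a probability space (OmegaT, Q) *)
  (dT : measure_display) (OmegaT : measurableType dT) (Q : probability OmegaT R)
  (Xt : OmegaT -> d.-tuple R) (xit : OmegaT -> R)
  (hXt : has_law Q Xt mu) (hxitm : measurable_fun [set: OmegaT] xit)
  (hcondt : cond_exp_const Q Xt xit 0)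
  (hxit2 : Q.-integrable [set: OmegaT] (fun w => (xit w ^+ 2)%:E) /\
           (\int[Q]_w (xit w ^+ 2)%:E = 1)%E)
  (* ridge parameter and eigenvalues of K (with multiplicity) *)
  (rho : R) (hrho : 0 < rho)
  (gam : Omega -> 'I_n -> R)
  (hgam : forall w, char_poly (gram (fun i => X i w)) =
                    \prod_(i < n) ('X - (gam w i)%:P)) :
  let fstar := fun x : d.-tuple R => dotv theta x in
  let Rk := risk Q Xt xit fstar in
  (* kernel ridge regression predictor *)
  let f := fun w => krr (fun i => X i w) (fun i => fstar (X i w) + xi i w) rho in
  let Phi := avg_mx lam phi in
  let zeta1 := Rintegral P [set: Omega]
     (fun w => \sum_(i < n) gam w i ^+ 2 / (gam w i + rho) ^+ 2) in
  let zeta2 := Rintegral P [set: Omega]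
     (fun w => (\sum_(i < n) gam w i / (gam w i + rho)) ^+ 2) in
  let T1 := (dotv theta theta * (d%:R * zeta1 - zeta2) * (d%:R - frob2 Phi))
            / (d%:R * (d%:R + 2) * (d%:R - 1)) in
  let T2 := (d%:R - frob2 Phi)
            / (d%:R * Num.sqrt n%:R + rho / Num.sqrt n%:R) ^+ 2 in
  let Mk := sup [set dotv x x | x in @sphere R d] in
  let kperp2 := (\int[mu]_x \int[mu]_y
       ((dotv x y - avgO lam phi (fun z => dotv x z) y) ^+ 2)%:E)%E in
  forall (fp : Omega -> d.-tuple R -> R),
    (forall w, (Rk (fp w) <= Rk (avgO lam phi (f w)))%E) ->
    measurable_fun [set: Omega] (fun w => Rk (fp w)) ->
  forall (wL : Omega -> d.-tuple R),
    (* x |-> (wL w)^T x is Lambda_{n,rho} f* for the sample at w *)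
    (forall w, ridge_min (fun i => X i w) fstar rho (wL w)) ->
  [/\ ((T1 + T2)%:E <= \int[P]_w (Rk (f w) - Rk (fp w)))%E,
      0 <= T1, 0 <= T2,
      T1%:E = (\int[P]_w L2norm2 mu
                 (fun x => (dotv (wL w) x - avgO lam phi (dotv (wL w)) x)%R))%E
    & T2%:E = (kperp2 * ((Num.sqrt n%:R * Mk + rho / Num.sqrt n%:R) ^+ 2)^-1%:E)%E
      /\ Mk = d%:R].
Proof.
move=> fstar Rk f Phi zeta1 zeta2 T1 T2 Mk kperp2 fp hfp mfp wL hwL.
have d0 : (0 < d)%N := ltnW hd.
pose th := cvt theta; pose S w := [tuple X i w | i < n].
pose H w := hat rho (S w); pose M w := weight rho (S w).
pose C : 'M[R]_d := 1%:M - Phi.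
have PhiT : Phi^T = Phi := avg_mx_sym hG hlam hphi.
have PhiP : Phi *m Phi = Phi := avg_mx_idem hG hlam hphi.
have CT : C^T = C by rewrite trmxB trmx1 PhiT.
have Phith : Phi *m th = th.
  apply: (avg_mx_invariant hG hlam hphi) => g x.
  by apply: invariant_on_sphere; exact: hinv.
have Cth : C *m th = 0 by rewrite mulmxBl mul1mx Phith subrr.
have froC : fro C = d%:R - frob2 Phi by exact: fro_projectionC.
(* Independence of the inputs comes from that of the pairs by taking boxes with a full noise
   side. *)
have indX : mutually_independent P X.
  move=> A mA; have := hind (fun i => A i `*` setT) (fun i => measurableX (mA i) measurableT).
  rewrite (_ : \bigcap_(i in _) _ = \bigcap_(i in [set: 'I_n]) X i @^-1` A i); last first.
    apply/seteqP; split => w Aw i _; first by have [] := Aw i Logic.I.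
    by split => //; exact: Aw.
  move=> ->; apply: eq_bigr => i _; congr (P _).
  by apply/seteqP; split => [w []//|w Aw]; split.
have mS : measurable_fun [set: Omega] S := measurable_sample hXlaw.
(* The operator id - O acts on linear functionals by applying [C] to the weight vector. *)
have avgE v x : dot v (cvt x) - avgO lam phi (fun z => dot v (cvt z)) x =
    dot (C *m v) (cvt x).
  by rewrite (avgO_dot _ hphi) -dotBr -{1}(mul1mx (cvt x)) -mulmxBl dot_mulmx CT.
have dotvE (v : d.-tuple R) : dotv v = (fun z => dot (cvt v) (cvt z)).
  by apply/funext => z; rewrite dotv_cvt.
(* The spectral sums in [zeta1] and [zeta2] are the trace of H^2 and the squared trace of H. *)
have T1E : T1 = \int[P]_w fro (C *m (H w *m th)).
  rewrite (hat_second_moment hd hrho hmu hXlaw indX Cth) /T1 froC dotv_cvt dotvv.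
  congr (_ * (_ * _ - _) * _ / _); apply: eq_Rintegral => w _.
    by rewrite (mxtrace_ridge_hat_sqr hrho (gam := gam w))// -gram_sample.
  by rewrite (mxtrace_ridge_hat hrho (gam := gam w))// -gram_sample.
have bCH : bmeas (fun w => fro (C *m (H w *m th))).
  apply: bmeas_fro; apply: mxbmeasM; first exact: mxbmeas_cst.
  apply: mxbmeasM; last exact: mxbmeas_cst.
  exact: mxbmeas_hat_sample.
have T1_0 : 0 <= T1.
  by rewrite T1E; apply: Rintegral_ge0 => w _; exact: fro_ge0.
have T2_0 : 0 <= T2 by rewrite /T2 -froC divr_ge0 ?fro_ge0 ?sqr_ge0.
have MkE : Mk = d%:R.
  rewrite /Mk (_ : [set _ | _ in _] = [set d%:R]) ?sup1//.
  apply/seteqP; split => [_ [x sx <-]//|_ ->].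
  (* The all-ones vector has squared length d, so the sphere is nonempty and the supremum is that of
     a singleton. *)
  have dot1 : dotv [tuple (1 : R) | _ < d] [tuple 1 | _ < d] = d%:R.
    rewrite /dotv; under eq_bigr do rewrite tnth_mktuple mulr1.
    by rewrite sumr_const card_ord.
  by exists [tuple 1 | _ < d].
split => //.
- pose noise w := \col_i xi i w.
  pose v w := H w *m th + M w *m noise w.
  have fE w : f w = (fun x => dot (v w) (cvt x)).
    apply/funext => x; rewrite /f krr_weight; congr (dot _ _).
    rewrite /v /H /hat -mulmxA -mulmxDr design_cvt; congr (_ *m _).
    by apply/matrixP => i j; rewrite !mxE /fstar !dotv_cvt dotC.
  have riskE u : Rk (fun x => dot u (cvt x)) = (fro (u - th) + 1)%:E.
    rewrite -(linear_risk d0 hmu hXt hxitm hcondt hxit2 (u - th)).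
    by apply: eq_integral => w _; rewrite /fstar dotv_cvt dotBl opprD addrA.
  have avgfE w : avgO lam phi (f w) = (fun x => dot (Phi *m v w) (cvt x)).
    by apply/funext => x; rewrite fE (avgO_dot _ hphi) dot_mulmx PhiT.
  (* Pythagoras for v - theta: [Phi] fixes theta and [C] kills it, so averaging removes exactly |C
     v|^2 from the risk. *)
  have gain w : fro (v w - th) + 1 = fro (Phi *m v w - th) + 1 + fro (C *m v w).
    rewrite (projection_pythagoras (v w - th) PhiT PhiP) !mulmxBr Phith Cth subr0.
    by rewrite addrAC.
  (* The risk of [fp] is nonnegative and at most the finite risk of the averaged predictor, so the
     infinite cases are contradictory and the subtraction is one of reals. *)
  have lb w : ((fro (C *m v w))%:E <= Rk (f w) - Rk (fp w))%E.
    have := hfp w; rewrite avgfE fE !riskE gain.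
    have : (0 <= Rk (fp w))%E by apply: integral_ge0 => z _; rewrite lee_fin sqr_ge0.
    by case: (Rk (fp w)) => [r| |]//; rewrite -EFinB !lee_fin; lra.
  have CvE w : C *m v w = C *m (H w *m th) + (C *m M w) *m noise w.
    by rewrite /v mulmxDr -[(C *m M w) *m noise w]mulmxA.
  have bh : mxbmeas (fun t : n.-tuple (d.-tuple R) => C *m (hat rho t *m th)).
    apply: mxbmeasM; first exact: mxbmeas_cst.
    by apply: mxbmeasM; [exact: mxbmeas_hat|exact: mxbmeas_cst].
  have bw : mxbmeas (fun t : n.-tuple (d.-tuple R) => C *m weight rho t).
    by apply: mxbmeasM; [exact: mxbmeas_cst|exact: mxbmeas_weight].
  have iCv : P.-integrable [set: Omega] (EFin \o (fun w => fro (C *m v w))).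
    have := integrable_noise_energy mS hcond1 hcond2 bh bw.
    by apply: eq_integrable => // w _ /=; rewrite CvE.
  have mv : mxmeas v.
    apply: mxmeasD.
      apply: mxmeasM; last exact: mxmeas_cst.
      by move=> i j; exact: (mxbmeas_hat_sample hrho hXlaw i j).1.
    apply: mxmeasM; first by move=> i j; exact: (mxbmeas_weight_sample hrho hXlaw i j).1.
    by move=> i j; under eq_fun do rewrite mxE; exact: hxim.
  apply: (@le_trans _ _ (\int[P]_w (fro (C *m v w))%:E)%E).
    rewrite RintegralE// lee_fin.
    under eq_Rintegral do rewrite CvE.
    rewrite (noise_energy mS hcond1 hcond2 bh bw) T1E lerD2l.
    apply: le_trans (weight_second_moment_ge hd hrho hmu hXlaw C).
    rewrite /T2 -froC.
    have n0 : 0 < n%:R :> R by rewrite ltr0n.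
    set s := Num.sqrt n%:R; have s2 : s ^+ 2 = n%:R by rewrite sqr_sqrtr.
    have s0 : 0 < s by rewrite sqrtr_gt0.
    have e0 : 0 < d%:R * s ^+ 2 + rho by rewrite ltr_wpDl// mulr_ge0// sqr_ge0.
    (* With s = sqrt n, both bounds are |C|^2 s^2 / (d s^2 + rho)^2. *)
    rewrite -s2 (_ : d%:R * s + rho / s = (d%:R * s ^+ 2 + rho) / s); last first.
      by field; rewrite gt_eqF.
    rewrite le_eqVlt; apply/orP; left; apply/eqP; field.
    by rewrite !gt_eqF.
  apply: ge0_le_integral => //.
  + by move=> w _; rewrite lee_fin fro_ge0.
  + by case/integrableP : iCv.
  + apply: emeasurable_funB => //.
    rewrite (_ : (fun w => Rk (f w)) = (fun w => (fro (v w - th) + 1)%:E)); last first.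
      by apply/funext => w; rewrite fE riskE.
    apply/measurable_EFinP; apply: measurable_funD; last exact: measurable_cst.
    by apply: measurable_fro; apply: mxmeasD => //; exact: mxmeas_cst.
- rewrite T1E -RintegralE; last exact: bmeas_integrable.
  apply: eq_integral => w _; rewrite /L2norm2 -(ridge_min_hat hrho (hwL w)).
  rewrite dotvE -(sphere_second_moment hmu d0 (C *m cvt (wL w))).
  by apply: eq_integral => x _; rewrite avgE.
- split => //; rewrite MkE.
  (* For fixed x, the function y |-> k^perp(x, y) is linear with weights C x. The inner integral is
     therefore |C x|^2, and the outer one |C|_F^2. *)
  have -> : kperp2 = (fro C)%:E.
    rewrite -(integral_fro_sphere C d0 hmu); apply: eq_integral => x _.
    rewrite dotvE -(sphere_second_moment hmu d0 (C *m cvt x)).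
    by apply: eq_integral => y _; rewrite avgE.
  by rewrite -EFinM /T2 -froC (mulrC d%:R).
Qed.
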